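(* Let $\beta>0$ and let $h\in\mathcal{G}$ be a $\mathcal{C}^2$-diffeomorphism of $S^1$. Then the map $\tau_h:\mathcal{G}\to\mathcal{G}$, $g\mapsto h\circ g$, is bijective and leaves $\mathbb{Q}^\beta$ quasi-invariant: the push forward of $\mathbb{Q}^\beta$ under $\tau_h^{-1}=\tau_{h^{-1}}$ is absolutely continuous with respect to $\mathbb{Q}^\beta$ with density $$\frac{d(\tau_{h^{-1}})_*\mathbb{Q}^\beta}{d\mathbb{Q}^\beta}(g)=Y_h^\beta(g).$$ Moreover, the function $Y_h^\beta$ is bounded from above and from below away from $0$ on $\mathcal{G}$.
   Context: $S^1=\mathbb{R}/\mathbb{Z}$; for $x,y\in S^1$, $y-x$ denotes the length $|[x,y]|$ of the positively oriented arc from $x$ to $y$. $\mathcal{G}$ is the set of maps $g:S^1\to S^1$ induced by right continuous nondecreasing $\tilde g:\mathbb{R}\to\mathbb{R}$ with $\tilde g(x+1)=\tilde g(x)+1$ (a semigroup under composition). For $\beta>0$, $\mathbb{Q}^\beta$ is the probability measure on $\mathcal{G}$ such that for each ordered family $t_1,\dots,t_N\in S^1$ (i.e. $\sum_i|[t_i,t_{i+1}]|=1$, $t_{N+1}:=t_1$) the law of $(g(t_1),\dots,g(t_N))$ is $\frac{\Gamma(\beta)}{\prod_{i=1}^N\Gamma(\beta|[t_i,t_{i+1}]|)}\prod_{i=1}^N|[x_i,x_{i+1}]|^{\beta|[t_i,t_{i+1}]|-1}dx_1\cdots dx_N$ on $\{(x_i)\in(S^1)^N:\sum_i|[x_i,x_{i+1}]|=1\}$,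 $x_{N+1}:=x_1$. For $g,h\in\mathcal{G}$ with $h\in\mathcal{C}^2$ strictly increasing, let $J_g\subset S^1$ be the set of jump locations of $g$, $g(a\pm)$ the one-sided limits, $\frac{\delta(h\circ g)}{\delta g}(a):=\frac{h(g(a+))-h(g(a-))}{g(a+)-g(a-)}$, and $$Y_h^0(g):=\prod_{a\in J_g}\frac{\sqrt{h'(g(a-))\,h'(g(a+))}}{\frac{\delta(h\circ g)}{\delta g}(a)},\qquad X_h^\beta(g):=\exp\Big(\beta\int_0^1\log h'(g(s))\,ds\Big),\qquad Y_h^\beta:=X_h^\beta\cdot Y_h^0$$ (the infinite product converges for all such $g,h$). *)

(* Defs.v *)
From HB Require Import structures.
From mathcomp Require Import all_boot all_order all_algebra.
From mathcomp Require Import all_classical all_reals all_analysis.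
Set Implicit Arguments. Unset Strict Implicit. Unset Printing Implicit Defensive.
Import Order.TTheory GRing.Theory Num.Theory.
Import numFieldNormedType.Exports.
Local Open Scope classical_set_scope.
Local Open Scope ring_scope.

Section Defs.
Variable R : realType.

(* S^1 = R/Z : a point of S^1 is represented by any real lift; [frac x] is its
   representative in [0,1). *)
Definition frac (x : R) : R := x - (Num.floor x)%:~R.

Definition arc (x y : R) : R := frac (y - x).

(* A lift g~ : R -> R of an element g of the semigroup G: right continuous,
   nondecreasing, g~(x+1) = g~(x) + 1. *)
Definition isGlift (f : R -> R) : Prop :=
  {homo f : x y / x <= y} /\
  (forall x, f y @[y --> x^'+] --> f x) /\
  (forall x, f (x + 1) = f x + 1).

(* Each g in G has exactly one lift with g~(0) in [0,1); we use it as the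
   canonical representative of g. *)
Definition isG (f : R -> R) : Prop := isGlift f /\ 0 <= f 0 < 1.

Definition Gty := {f : R -> R | `[< isG f >]}.

Lemma id_isG : `[< isG id >].
Proof.
apply/asboolP; split; last by rewrite lexx ltr01.
split; first by move=> x y.
split=> // x; apply: cvg_at_right_filter; exact: cvg_id.
Qed.

HB.instance Definition _ := [Choice of Gty by <:].
HB.instance Definition _ := isPointed.Build Gty (exist _ id id_isG).

Definition evG (t : R) (g : Gty) : R := frac (sval g t).

Definition evsets : set (set Gty) :=
  [set A | exists t (B : set R), measurable B /\ A = evG t @^-1` B].

Definition Gmeas := g_sigma_algebraType evsets.

Definition normlift (f : R -> R) : R -> R := fun x => f x - (Num.floor (f 0))%:~R.

Definition tau (h : R -> R) (g : Gty) : Gty :=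
  insubd g (normlift (h \o sval g)).

Definition Gamma (s : R) : R :=
  fine (\int[lebesgue_measure]_(x in `]0%R, +oo[%classic)
          (powR x (s - 1) * expR (- x))%:E)%E.

Definition nxt (N i : nat) : nat := if i.+1 == N then 0%N else i.+1.

Definition dirdens (beta : R) (N : nat) (t x : nat -> R) : R :=
  if \sum_(i < N) arc (x i) (x (nxt N i)) == 1 then
    Gamma beta / (\prod_(i < N) Gamma (beta * arc (t i) (t (nxt N i)))) *
    \prod_(i < N) powR (arc (x i) (x (nxt N i))) (beta * arc (t i) (t (nxt N i)) - 1)
  else 0.

Fixpoint iint (n : nat) (F : (nat -> R) -> \bar R) : \bar R :=
  if n is m.+1 then
    (\int[lebesgue_measure]_(y in `[0%R, 1%R[%classic)
       iint m (fun x => F (fun i => if i == m then y else x i)))%E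
  else F (fun _ => 0).

(* Q is the measure Q^beta: for every cyclically ordered family t_0,...,t_{N-1}
   of distinct points, the law of (g(t_0),...,g(t_{N-1})) has density dirdens
   on (S^1)^N = [0,1)^N (tested on all boxes, which determine the law). *)
Definition isQbeta (beta : R) (Q : probability Gmeas R) : Prop :=
  forall (N : nat) (t : nat -> R),
    (2 <= N)%N ->
    (forall i, (i < N)%N -> 0 < arc (t i) (t (nxt N i))) ->
    \sum_(i < N) arc (t i) (t (nxt N i)) = 1 ->
    forall a b : nat -> R, (forall i, (i < N)%N -> 0 <= a i <= b i /\ b i <= 1) ->
      Q [set g : Gmeas | forall i, (i < N)%N -> a i <= evG (t i) g < b i] =
      iint N (fun x => ((\prod_(i < N) (if (a i <= x i < b i)%R then 1 else 0)) * dirdens beta N t x)%:E).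

Definition isC2 (f : R -> R) : Prop :=
  (forall x, derivable f x 1) /\ (forall x, derivable (derive1 f) x 1) /\
  continuous (derive1 (derive1 f)).

Definition leftlim (f : R -> R) (a : R) : R := sup [set f x | x in [set x | x < a]].

Definition jumps (g : Gty) : set R :=
  [set a | 0 <= a < 1 /\ leftlim (sval g) a < sval g a].

Definition Yfactor (h : R -> R) (g : Gty) (a : R) : R :=
  let gm := leftlim (sval g) a in let gp := sval g a in
  Num.sqrt (derive1 h gm * derive1 h gp) / ((h gp - h gm) / (gp - gm)).

(* sum over a countable set of reals of an absolutely summable family:
   sum of positive parts minus sum of negative parts *)
Definition ssum (J : set R) (u : R -> R) : R :=
  fine (\esum_(a in J) (Num.max (u a) 0)%:E)%E -
  fine (\esum_(a in J) (Num.max (- u a) 0)%:E)%E.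

(* Y^0_h(g) = prod_{a in J_g} Yfactor a   (the product converges absolutely) *)
Definition Y0 (h : R -> R) (g : Gty) : R := expR (ssum (jumps g) (fun a => ln (Yfactor h g a))).

Definition Xb (beta : R) (h : R -> R) (g : Gty) : R :=
  expR (beta * fine (\int[lebesgue_measure]_(s in `[0%R, 1%R]%classic)
                         (ln (derive1 h (sval g s)))%:E)%E).

Definition Yb (beta : R) (h : R -> R) (g : Gty) : R := Xb beta h g * Y0 h g.

End Defs.

(* Main.v *)
(** Two ingredients: an exact finite-dimensional formula and a pointwise limit.
    For the nodes t_i = i/N the law of (g(t_i)) is an explicit density, so the
    substitution x_i = h(y_i) shows that the law of (h^-1 (g(t_i))) has, with
    respect to the law of (g(t_i)), the density [Ynode]
      prod_i (Delta_i (h o g) / Delta_i g)^(beta/N - 1) h'(g(t_i)).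
    After cyclic resummation its logarithm is the sum of a Riemann sum
      (beta/N) sum_i ln (Delta_i (h o g) / Delta_i g)
    and of sum_i defect (g t_i) (g t_(i+1)), where
      defect x y = (ln h' x + ln h' y)/2 - ln ((h y - h x)/(y - x)).
    As h is C^2, the defect is O(y - x) in general and o(y - x) for small
    increments, so only the jumps of g contribute in the limit, and [Ynode] is
    bounded between two positive constants uniformly in g and N.  Hence [Ynode]
    converges boundedly to Y_h^beta, and the formula passes to the limit on
    cylinder sets over dyadic nodes, which generate the sigma-algebra. *)

(* The resummation is what makes a termwise estimate possible. In [Ynode] each increment is weighted
   by [h'] at its left end, which differs from the chord to first order; the increments add up to 1,
   so such errors are not small in total. Moving half of each weight to the right end costs nothing
   on a circle and leaves the error of the trapezoidal rule, which is of smaller order. The same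
   symmetrization is the origin of the square root in [Yfactor]. Large increments are isolated by
   finitely many points: away from them every increment is below a prescribed size, and a bound
   [e * (y - x)] then sums to at most [e]. The limit is established for every [g], not just almost
   every one, because the bounds on [Yb] are claimed on all of G. This forces the case in which all
   node values coincide on the circle; the Dirichlet density vanishes there, so [Ynode] may be given
   the value that fits the limit. Dyadic grids are nested: a cylinder set over one grid is a
   cylinder set over every finer one, so the left side of the finite-dimensional formula stays fixed
   while the density converges. *)
Require Import Defs.
From HB Require Import structures.
From mathcomp Require Import all_boot all_order all_algebra.
From mathcomp Require Import all_classical all_reals all_analysis.
From mathcomp Require Import measurable_realfun zify ring lra.
Import Order.TTheory GRing.Theory Num.Theory.
Import numFieldNormedType.Exports Defs.
Local Open Scope classical_set_scope.
Local Open Scope ring_scope.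
Set Implicit Arguments.
Unset Strict Implicit.
Unset Printing Implicit Defensive.

(** * Circle coordinates and calculus *)

Section Frac.
Context {R : realType}.
Implicit Types (x y : R) (k : int).

Lemma frac_itv x : 0 <= frac x < 1.
Proof. by have := floor_itv x; rewrite /frac intrD; lra. Qed.

Lemma frac_eq x y k : 0 <= y < 1 -> x = y + k%:~R -> frac x = y.
Proof.
move=> hy ->; rewrite /frac (@floor_def _ _ k) ?addrK// intrD; lra.
Qed.

Lemma frac_id x : 0 <= x < 1 -> frac x = x.
Proof. by move=> hx; apply: (@frac_eq _ _ 0) => //; rewrite addr0. Qed.

Lemma fracDz x k : frac (x + k%:~R) = frac x.
Proof.
apply: (@frac_eq _ _ (Num.floor x + k)); first exact: frac_itv.
by rewrite /frac intrD; ring.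
Qed.

Lemma fracBz x k : frac (x - k%:~R) = frac x.
Proof. by rewrite -mulrNz fracDz. Qed.

Lemma measurable_frac : measurable_fun [set: R] (@frac R).
Proof.
apply: measurable_funB; first exact: measurable_id.
apply: nondecreasing_measurable => // x y xy.
by rewrite ler_int; exact: le_floor.
Qed.

Lemma isGliftDz (f : R -> R) : isGlift f -> forall x k, f (x + k%:~R) = f x + k%:~R.
Proof.
case=> _ [_ f1]; have fn (n : nat) : forall x, f (x + n%:R) = f x + n%:R.
  elim: n => [|n IHn] x; first by rewrite !addr0.
  by rewrite -natr1 !addrA f1 IHn.
move=> x [n|n]; first by rewrite -!pmulrn fn.
by rewrite NegzE !mulrNz -!pmulrn -[in RHS](subrK n.+1%:R x) fn addrK.
Qed.

Lemma frac_isGlift (f : R -> R) : isGlift f -> forall x, frac (f (frac x)) = frac (f x).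
Proof. by move=> fG x; rewrite {2}/frac -mulrNz isGliftDz// mulrNz fracBz. Qed.

End Frac.

Section Calculus.
Context {R : realType}.
Implicit Types (f g df : R -> R) (x y z : R).

Lemma MVT_le f df x y : (forall z, is_derive z 1 f (df z)) -> x <= y ->
  exists2 c, x <= c <= y & f y - f x = df c * (y - x).
Proof.
move=> fd xy.
have fc : {within `[x, y], continuous f}.
  apply: continuous_subspaceT => z; apply: differentiable_continuous.
  by apply/derivable1_diffP; exact: ex_derive.
have [c cI e] := MVT_segment xy (fun z _ => fd z) fc.
by exists c => //; rewrite in_itv in cI.
Qed.

(** The constant [c] covers both [h] ([c = 1]) and [derive1 h] ([c = 0]). *)
Lemma derive1_periodic f (c : R) : (forall x, f (x + 1) = f x + c) ->
  forall x, derive1 f (x + 1) = derive1 f x.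
Proof.
move=> f1 x; rewrite /derive1.
rewrite (_ : (fun t : R => _) = (fun t => t^-1 *: (f (t + x) - f x)))//.
by apply/funext => t; rewrite addrA !f1; congr (_ *: _); ring.
Qed.

Lemma periodic_frac f : (forall x, f (x + 1) = f x) -> forall x, f (frac x) = f x.
Proof.
move=> f1; have fn (n : nat) : forall x, f (x + n%:R) = f x.
  by elim: n => [|n IHn] x; rewrite ?addr0// -natr1 addrA f1.
move=> x; rewrite /frac; case: (Num.floor x) => n; first by rewrite -pmulrn -[in RHS](subrK n%:R x) fn.
by rewrite NegzE mulrNz opprK -pmulrn fn.
Qed.

Lemma periodic_bounded f : continuous f -> (forall x, f (x + 1) = f x) ->
  exists2 K : R, 0 < K & forall x, `|f x| <= K.
Proof.
move=> fc f1; have fs : {within `[0, 1], continuous f} by apply: continuous_subspaceT.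
have [c _ fM] := EVT_max ler01 fs; have [d _ fm] := EVT_min ler01 fs.
exists (1 + `|f c| + `|f d|) => [|x]; first by have := normr_ge0 (f c); have := normr_ge0 (f d); lra.
have /andP[x0 x1] := frac_itv x.
have xI : frac x \in `[0, 1] by rewrite in_itv /= x0 ltW.
have := fM _ xI; have := fm _ xI; rewrite periodic_frac// => h1 h2.
rewrite ler_norml; have := ler_norm (f c); have := ler_norm (- f d); rewrite normrN.
by have := normr_ge0 (f c); have := normr_ge0 (f d); lra.
Qed.

Lemma periodic_lower_bound f : continuous f -> (forall x, f (x + 1) = f x) ->
  (forall x, 0 < f x) -> exists2 m : R, 0 < m & forall x, m <= f x.
Proof.
move=> fc f1 f0; have fs : {within `[0, 1], continuous f} by apply: continuous_subspaceT.
have [d _ fm] := EVT_min ler01 fs; exists (f d) => // x.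
have /andP[x0 x1] := frac_itv x.
by rewrite -(periodic_frac f1 x); apply: fm; rewrite in_itv /= x0 ltW.
Qed.

(** Compactness of [[0, 1]] gives uniformity for [x] in the segment and arbitrary [y]. In general
    both points are translated by the integer part of [x], which keeps their distance even if [y]
    leaves the segment. *)
Lemma periodic_unif_continuous f : continuous f -> (forall x, f (x + 1) = f x) ->
  forall e : R, 0 < e -> exists2 d : R, 0 < d & forall x y, `|x - y| < d -> `|f x - f y| < e.
Proof.
move=> fc f1 e e0.
have /compact_near_coveringP/(_ R 0^'+ (fun d x => forall y, `|x - y| < d -> `|f x - f y| < e) _) :=
  @segment_compact R 0 1.
case=> [x _|d /= d0 hd].
  have /cvgrPdist_lt/(_ (e / 2)) := fc x; case=> [|d /= d0 hd]; first by lra.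
  near=> z t => /= y zyt.
  have xz : `|x - z| < d / 2 by near: z; exists (d / 2) => //=; lra.
  have td : t < d / 2 by near: t; apply: nbhs_right_lt; lra.
  have /= h1 := hd z; have /= h2 := hd y.
  have : `|f x - f z| < e / 2 by apply: h1; lra.
  have : `|f x - f y| < e / 2.
    by apply: h2; have := ler_distD z x y; lra.
  by rewrite [X in _ -> X < _ -> _]distrC; have := ler_distD (f x) (f z) (f y); lra.
have d20 : 0 < d / 2 by lra.
exists (d / 2) => // x y xy.
have := hd (d / 2); rewrite /= sub0r normrN gtr0_norm// => /(_ _ d20 (frac x)).
have /andP[x0 x1] := frac_itv x.
rewrite ltr_pdivrMr ?ltr_pMr ?ltr1n// => /(_ isT).
move=> /(_ _ (y - (Num.floor x)%:~R)).
have -> : f (y - (Num.floor x)%:~R) = f y.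
  by rewrite -[LHS]periodic_frac// fracBz periodic_frac.
rewrite periodic_frac//; apply; first by rewrite /= in_itv /= x0 ltW.
apply: le_lt_trans (_ : `|x - y| < _); last lra.
by rewrite /frac (_ : x - _ - _ = x - y) //; ring.
Unshelve. all: by end_near.
Qed.

Lemma ln_diff_le (a b : R) : 0 < a -> 0 < b -> ln a - ln b <= (a - b) / b.
Proof.
move=> a0 b0; rewrite -ln_div ?posrE//.
have -> : a / b = 1 + (a - b) / b by field; rewrite gt_eqF.
apply: le_ln1Dx; rewrite mulrBl divff ?gt_eqF//.
by have := divr_gt0 a0 b0; lra.
Qed.

End Calculus.

(** * Difference quotients and the defect *)

Section GeometricMean.
Context {R : realType}.

(* [ln b - ln D <= (b - D) / D] and its mirror image bound the defect by the second difference [a + b - 2 D]. *)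
Lemma geometric_mean_le (m K w e a b D : R) : 0 < m -> 0 < K -> 0 <= w -> 0 < e ->
  m <= a <= K -> m <= b <= K -> m <= D <= K -> `|a - D| <= K * w -> `|b - D| <= K * w ->
  `|2 * D - a - b| <= e * m ^+ 2 / (2 * K + m) * w -> w <= e * m ^+ 2 / (2 * K ^+ 2) ->
  `|(ln a + ln b) / 2 - ln D| <= e * w.
Proof.
move=> m0 K0 w0 e0 /andP[ma aK] /andP[mf fK] /andP[mD DK] laD lfD tr xyd'.
have a0 : 0 < a by apply: lt_le_trans ma.
have f0 : 0 < b by apply: lt_le_trans mf.
have D0 : 0 < D by apply: lt_le_trans mD.
set e1 := e * m ^+ 2 / (2 * K + m) in tr.
have e10 : 0 < e1 by rewrite divr_gt0 ?mulr_gt0 ?exprn_gt0//; lra.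
have aK2 : `|(a - D) * (b - D)| <= K ^+ 2 * w ^+ 2.
  by rewrite normrM -exprMn expr2 ler_pM.
have u1 := ln_diff_le f0 D0; have u2 := ln_diff_le a0 D0.
have l1 := ln_diff_le D0 f0; have l2 := ln_diff_le D0 a0.
have trm : `|a + b - 2 * D| <= e1 * w.
  by rewrite -normrN (_ : - (a + b - 2 * D) = 2 * D - a - b)//; ring.
have e1K : e1 * (2 * K + m) = e * m ^+ 2 by rewrite /e1 divfK// gt_eqF//; lra.
have ww : 2 * K ^+ 2 * w ^+ 2 <= e * m ^+ 2 * w.
  rewrite (expr2 w) mulrA ler_wpM2r//; move: xyd'; rewrite ler_pdivlMr ?mulr_gt0 ?exprn_gt0//.
  by rewrite mulrC.
have up : (b - D) / D + (a - D) / D <= e * w.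
  rewrite -mulrDl ler_pdivrMr//.
  have -> : b - D + (a - D) = a + b - 2 * D by ring.
  apply: le_trans (ler_norm _) _; apply: le_trans trm _.
  rewrite (mulrAC e w D) ler_wpM2r//.
  apply: le_trans (_ : e * m <= _); last by rewrite ler_pM2l.
  rewrite /e1 ler_pdivrMr; last by lra.
  rewrite expr2 -!mulrA ler_pM2l// ler_pM2l//; lra.
(* The numerator over [a * b] consists of the second difference and of the product of the two
   deviations; the latter is quadratic in [w] and is absorbed by the smallness of [w]. The factor 2
   is harmless because the goal halves the logarithms. *)
have low : (D - b) / b + (D - a) / a <= 2 * (e * w).
  have -> : (D - b) / b + (D - a) / a =
      (- (D * (a + b - 2 * D)) - 2 * ((a - D) * (b - D))) / (a * b).
    by field; rewrite !gt_eqF.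
  rewrite ler_pdivrMr ?mulr_gt0//.
  have t1 : - (D * (a + b - 2 * D)) <= K * (e1 * w).
    apply: le_trans (ler_norm _) _; rewrite normrN normrM gtr0_norm//.
    by apply: ler_pM => //; exact: ltW.
  have t2 : - (2 * ((a - D) * (b - D))) <= e * m ^+ 2 * w.
    apply: le_trans (ler_norm _) _; rewrite normrN normrM gtr0_norm//.
    by apply: le_trans ww; rewrite -mulrA ler_pM2l.
  have t3 : K * (e1 * w) <= e * m ^+ 2 * w.
    rewrite mulrA ler_wpM2r// -e1K mulrC ler_pM2l//; clear -m0 K0; lra.
  have t4 : 2 * (e * w) * m ^+ 2 <= 2 * (e * w) * (a * b).
    rewrite ler_wpM2l ?mulr_ge0 ?(ltW e0)// expr2; apply: ler_pM => //; exact: ltW.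
  have t5 : 2 * (e * w) * m ^+ 2 = 2 * (e * m ^+ 2 * w) by ring.
  clear -t1 t2 t3 t4 t5; lra.
clear -u1 u2 l1 l2 up low w0 e0; have : 0 <= e * w by rewrite mulr_ge0// ltW.
rewrite ler_norml; lra.
Qed.

End GeometricMean.

Section Chord.
Context {R : realType}.
Implicit Types (h : R -> R) (x y : R).

(** The diagonal value is the limit of the quotients, so steps on which [g] is constant need no
    separate treatment. *)
Definition chord h x y := if x == y then derive1 h x else (h y - h x) / (y - x).

(** At the two one-sided limits of a jump this is the logarithm of [Yfactor]. *)
Definition defect h x y :=
  (ln (derive1 h x) + ln (derive1 h y)) / 2 - ln (chord h x y).

Lemma chordDz h x y k : isGlift h -> chord h (x + k%:~R) (y + k%:~R) = chord h x y.
Proof.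
move=> hG; rewrite /chord (can_eq (addrK _)) !(isGliftDz hG).
have -> : derive1 h (x + k%:~R) = derive1 h x.
  have h1 := derive1_periodic (fun z => hG.2.2 z).
  by rewrite -(periodic_frac h1) fracDz (periodic_frac h1).
by case: eqP => // _; congr (_ / _); ring.
Qed.

Lemma chord_mul h x y : chord h x y * (y - x) = h y - h x.
Proof.
by rewrite /chord; case: eqP => [->|/eqP xy]; rewrite ?subrr ?mulr0// divfK// subr_eq0 eq_sym.
Qed.

Lemma defectxx h x : defect h x x = 0.
Proof. by rewrite /defect /chord eqxx; lra. Qed.

End Chord.

Section Diffeo.
Context {R : realType} (h hinv : R -> R).
Hypothesis hG : isGlift h.
Hypothesis hC2 : isC2 h.
Hypothesis hinvC2 : isC2 hinv.
Hypothesis hK : cancel h hinv.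
Hypothesis hinvK : cancel hinv h.
Implicit Types (x y s t : R) (k : int).

Lemma derive1_is_derive (f : R -> R) : (forall x, derivable f x 1) ->
  forall x, is_derive x 1 f (derive1 f x).
Proof. by move=> fd x; apply: DeriveDef => //; rewrite derive1E. Qed.

Lemma derivable_continuous (f : R -> R) : (forall x, derivable f x 1) -> continuous f.
Proof. by move=> fd x; apply: differentiable_continuous; apply/derivable1_diffP. Qed.

Lemma diffeo_lt x y : (h x < h y) = (x < y).
Proof.
have hinj : injective h := can_inj hK.
case: (ltgtP x y) => [xy|yx|->]; last by rewrite ltxx.
- by rewrite lt_neqAle hG.1 ?ltW// andbT (inj_eq hinj) lt_eqF.
- by apply/negbTE; rewrite -leNgt hG.1// ltW.
Qed.

Lemma diffeo_le x y : (h x <= h y) = (x <= y).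
Proof. by rewrite !leNgt diffeo_lt. Qed.

Lemma isGlift_inv : isGlift hinv.
Proof.
split; [|split].
- by move=> x y xy; rewrite -diffeo_le !hinvK.
- by move=> x; apply: cvg_at_right_filter; exact: (derivable_continuous hinvC2.1).
- by move=> x; apply: (can_inj hK); rewrite hG.2.2 !hinvK.
Qed.

(** Monotonicity gives a nonnegative derivative, and the chain rule for [hinv \o h] excludes
    zero. *)
Lemma derive1_diffeo_gt0 x : 0 < derive1 h x.
Proof.
have hd := derive1_is_derive hC2.1; have gd := derive1_is_derive hinvC2.1.
have e : derive1 hinv (h x) * derive1 h x = 1.
  rewrite -derive1_comp; [|exact: hC2.1|exact: hinvC2.1].
  by rewrite (_ : hinv \o h = id) ?derive1_id//; apply/funext => z /=; rewrite hK.
have : 0 <= derive1 h x.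
  apply: (@incr_derive1_ge0_itvy _ h true (x - 1) x); last by rewrite in_itv /= andbT; lra.
    by move=> z _; exact: hC2.1.
  by move=> z t _ _; rewrite diffeo_lt.
by rewrite le_eqVlt => /orP[/eqP e0|//]; move: e; rewrite -e0 mulr0 => /esym/eqP; rewrite oner_eq0.
Qed.

Lemma derive1_diffeo_periodic x : derive1 h (x + 1) = derive1 h x.
Proof. exact: derive1_periodic hG.2.2 x. Qed.

Lemma derive1_diffeo_bounds : exists m K : R, [/\ 0 < m, 0 < K,
  forall x, m <= derive1 h x <= K & forall x y, `|derive1 h x - derive1 h y| <= K * `|x - y|].
Proof.
have c1 := derivable_continuous hC2.2.1.
have p2 : forall x, derive1 (derive1 h) (x + 1) = derive1 (derive1 h) x.
  by apply: (@derive1_periodic _ _ 0) => z; rewrite addr0 derive1_diffeo_periodic.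
have [m m0 hm] := periodic_lower_bound c1 derive1_diffeo_periodic derive1_diffeo_gt0.
have [K1 K10 hK1] := periodic_bounded c1 derive1_diffeo_periodic.
have [K2 K20 hK2] := periodic_bounded hC2.2.2 p2.
have lip x y : x <= y -> `|derive1 h x - derive1 h y| <= (K1 + K2) * `|x - y|.
  move=> xy; have [c _] := MVT_le (derive1_is_derive hC2.2.1) xy.
  rewrite distrC => ->; rewrite normrM distrC ler_wpM2r//.
  by apply: le_trans (hK2 c) _; lra.
exists m, (K1 + K2); split => //; first by lra.
  by move=> x; rewrite hm /=; have := hK1 x; rewrite ler_norml; lra.
move=> x y; case: (leP x y) => [/lip//|/ltW/lip].
by rewrite (distrC (derive1 h x)) (distrC x).
Qed.

Lemma chord_mvt x y : x <= y -> exists2 c, x <= c <= y & chord h x y = derive1 h c.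
Proof.
rewrite /chord; case: eqP => [-> _|/eqP xy lexy]; first by exists y; rewrite ?lexx.
have [c cI e] := MVT_le (derive1_is_derive hC2.1) lexy.
by exists c => //; rewrite e mulfK// subr_eq0 eq_sym.
Qed.

Lemma chord_gt0 x y : x <= y -> 0 < chord h x y.
Proof. by move=> /chord_mvt[c _ ->]; exact: derive1_diffeo_gt0. Qed.

(** A chord is a value of [h'] at an intermediate point, and [ln h'] is Lipschitz with constant
    [K / m]. The last bound averages the third one at [s = x] and [s = y]. One constant serves all
    four. *)
Lemma ln_chord_bounds : exists2 L : R, 0 < L &
  [/\ forall x, `|ln (derive1 h x)| <= L,
      forall x y, x <= y -> `|ln (chord h x y)| <= L,
      forall x y s, x <= s <= y -> `|ln (chord h x y) - ln (derive1 h s)| <= L * (y - x) &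
      forall x y, x <= y -> `|defect h x y| <= L * (y - x)].
Proof.
have [m [K [m0 K0 b lip]]] := derive1_diffeo_bounds.
pose B := `|ln m| + `|ln K|.
have bln x : `|ln (derive1 h x)| <= B.
  have /andP[h1 h2] := b x; have h0 := derive1_diffeo_gt0 x.
  have : ln m <= ln (derive1 h x) by rewrite ler_ln ?posrE.
  have : ln (derive1 h x) <= ln K by rewrite ler_ln ?posrE.
  have := ler_norm (ln K); have := ler_norm (- ln m); rewrite normrN.
  by rewrite ler_norml /B; have := normr_ge0 (ln m); have := normr_ge0 (ln K); lra.
have B0 : 0 <= B by apply: le_trans (bln 0).
have lnl x y : ln (derive1 h x) - ln (derive1 h y) <= K / m * `|x - y|.
  apply: le_trans (ln_diff_le _ _) _; [exact: derive1_diffeo_gt0..|].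
  rewrite ler_pdivrMr ?derive1_diffeo_gt0//; apply: le_trans (ler_norm _) _.
  apply: le_trans (lip _ _) _.
  have -> : K * `|x - y| = K / m * `|x - y| * m by field; rewrite gt_eqF.
  by rewrite ler_wpM2l ?mulr_ge0 ?invr_ge0//; [exact: ltW..|have /andP[] := b y].
have Km0 : 0 < K / m by rewrite divr_gt0.
have lnc x y s : x <= s <= y -> `|ln (chord h x y) - ln (derive1 h s)| <= K / m * (y - x).
  move=> /andP[xs sy]; have [c /andP[xc cy] ->] := chord_mvt (le_trans xs sy).
  have d : `|c - s| <= y - x by rewrite ler_norml; lra.
  rewrite ler_norml lerNl opprB; apply/andP; split.
    by apply: le_trans (lnl _ _) _; rewrite ler_pM2l// distrC.
  by apply: le_trans (lnl _ _) _; rewrite ler_pM2l.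
exists (1 + B + K / m); first by lra.
split.
- by move=> x; apply: le_trans (bln x) _; lra.
- move=> x y /chord_mvt[c _ ->].
  by apply: le_trans (bln c) _; lra.
- move=> x y s xsy; apply: le_trans (lnc _ _ _ xsy) _.
  by rewrite ler_wpM2r//; lra.
- move=> x y xy; have h1 := lnc x y x; have h2 := lnc x y y.
  rewrite !lexx xy /= in h1 h2; have {}h1 := h1 isT; have {}h2 := h2 isT.
  have : 0 <= (1 + B) * (y - x) by apply: mulr_ge0; [rewrite addr_ge0|rewrite subr_ge0].
  rewrite /defect; move: h1 h2; rewrite !ler_norml; lra.
Qed.

(** The error of the trapezoidal rule, with [h''] merely continuous: its uniform continuity replaces
    a bound on a third derivative. *)
Lemma trapezoid e : 0 < e -> exists2 d : R, 0 < d & forall x y, x <= y -> y - x < d ->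
  `|2 * chord h x y - derive1 h x - derive1 h y| <= e * (y - x).
Proof.
move=> e0; have p2 : forall x, derive1 (derive1 h) (x + 1) = derive1 (derive1 h) x.
  by apply: (@derive1_periodic _ _ 0) => z; rewrite addr0 derive1_diffeo_periodic.
have [d d0 hd] := periodic_unif_continuous hC2.2.2 p2 e0.
exists d => // x y xy xyd.
have [->|xyN] := eqVneq x y; first by rewrite /chord eqxx subrr mulr0 (_ : _ - _ - _ = 0) ?normr0//; ring.
have xy0 : 0 < y - x by rewrite subr_gt0 lt_neqAle xyN.
(* The increment of [F] over [[x, y]] is [y - x] times the quantity to bound. At the mean value
   point [c], [dF c] is a difference of two values of [h''] times [c - x], since [h' c - h' x] is
   again a mean value. *)
pose F s := 2 * h s - (s - x) * (derive1 h x + derive1 h s).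
pose dF s := 2 * derive1 h s - ((derive1 h x + derive1 h s) + (s - x) * derive1 (derive1 h) s).
have Fd s : is_derive s 1 F (dF s).
  have i1 := derive1_is_derive hC2.1 s; have i2 := derive1_is_derive hC2.2.1 s.
  apply: is_derive_eq; rewrite /dF /=; rewrite /GRing.scale /=; ring.
have [c /andP[xc cy] eF] := MVT_le Fd xy.
have [c' /andP[xc' cy'] ec'] := MVT_le (derive1_is_derive hC2.2.1) xc.
have -> : 2 * chord h x y - derive1 h x - derive1 h y = (F y - F x) / (y - x).
  have := chord_mul h x y; rewrite /F => ch.
  apply: (mulIf (lt0r_neq0 xy0)); rewrite divfK ?lt0r_neq0//.
  by rewrite !mulrBl -mulrA ch; ring.
rewrite eF mulfK ?lt0r_neq0//.
have -> : dF c = (derive1 (derive1 h) c' - derive1 (derive1 h) c) * (c - x).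
  have alg (a b r s t : R) : b - a = s * t -> 2 * b - (a + b + t * r) = (s - r) * t.
    by move=> eab; rewrite mulrBl -eab; ring.
  exact: alg ec'.
rewrite normrM; apply: ler_pM => //; last by rewrite ger0_norm; lra.
by apply/ltW/hd; rewrite ltr_norml; lra.
Qed.

Lemma defect_littleo (e : R) : 0 < e -> exists2 d : R, 0 < d & forall x y, x <= y -> y - x < d ->
  `|defect h x y| <= e * (y - x).
Proof.
move=> e0; have [m [K [m0 K0 b lip]]] := derive1_diffeo_bounds.
(* [e1] and [d'] below are the tolerances that [geometric_mean_le] requires for [w = y - x]. *)
pose e1 := e * m ^+ 2 / (2 * K + m).
have e10 : 0 < e1 by rewrite divr_gt0 ?mulr_gt0 ?exprn_gt0//; lra.
have [d d0 hd] := trapezoid e10.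
pose d' := e * m ^+ 2 / (2 * K ^+ 2).
have d'0 : 0 < d' by rewrite divr_gt0 ?mulr_gt0 ?exprn_gt0//; lra.
exists (Num.min d d'); first by rewrite lt_min d0.
move=> x y xy; rewrite lt_min => /andP[xyd xyd'].
have := hd x y xy xyd; rewrite /defect.
have [c /andP[xc cy] ->] := chord_mvt xy => tr.
have w0 : 0 <= y - x by rewrite subr_ge0.
apply: (@geometric_mean_le _ m K (y - x) e) => //; rewrite ?b//.
- by apply: le_trans (lip _ _) _; rewrite ler_pM2l// ler_norml; lra.
- by apply: le_trans (lip _ _) _; rewrite ler_pM2l// ler_norml; lra.
- exact: ltW.
Qed.

Lemma defectDz x y k : defect h (x + k%:~R) (y + k%:~R) = defect h x y.
Proof.
have h1 := derive1_diffeo_periodic.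
have pk z : derive1 h (z + k%:~R) = derive1 h z.
  by rewrite -(periodic_frac h1) fracDz (periodic_frac h1).
by rewrite /defect (chordDz _ _ _ hG) !pk.
Qed.

End Diffeo.

(** * Lifts: one-sided limits and jumps *)

Section Lift.
Context {R : realType} (f : R -> R).
Hypothesis fG : isGlift f.
Implicit Types (a s t e : R).

Lemma lift_right_cont a e : 0 < e ->
  exists2 r : R, 0 < r & forall s, a <= s < a + r -> f s < f a + e.
Proof.
move=> e0; have /cvgrPdist_lt/(_ e e0) := fG.2.1 a; case=> r /= r0 hr.
exists r => // s /andP[]; rewrite le_eqVlt => /orP[/eqP <- _|as_ sr]; first by rewrite ltrDl.
have : `|f a - f s| < e by apply: hr => //=; rewrite ltr_norml; lra.
by rewrite ltr_norml; lra.
Qed.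

Lemma lift_le_leftlim a s : s < a -> f s <= leftlim f a.
Proof.
move=> sa; apply: ub_le_sup; last by exists s.
by exists (f a) => _ [x /= xa <-]; apply: fG.1; exact: ltW.
Qed.

Lemma leftlim_le a s : a <= s -> leftlim f a <= f s.
Proof.
move=> as_; apply: ge_sup; first by exists (f (a - 1)); exists (a - 1) => //=; lra.
by move=> _ [x /= xa <-]; apply: fG.1; apply: le_trans as_; exact: ltW.
Qed.

Lemma lift_left_lim a e : 0 < e ->
  exists2 r : R, 0 < r & forall s, a - r <= s -> s < a -> leftlim f a - e < f s.
Proof.
move=> e0; have hs : has_sup [set f x | x in [set x | x < a]].
  split; first by exists (f (a - 1)); exists (a - 1) => //=; lra.
  by exists (f a) => _ [x /= xa <-]; apply: fG.1; exact: ltW.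
have [_ [x /= xa <-] hx] := sup_adherent e0 hs.
exists (a - x); first by lra.
by move=> s as_ sa; apply: lt_le_trans hx _; apply: fG.1; lra.
Qed.

Lemma leftlimD1 a : leftlim f (a + 1) = leftlim f a + 1.
Proof.
apply/eqP; rewrite eq_le; apply/andP; split.
- apply: ge_sup; first by exists (f (a - 1)); exists (a - 1) => //=; lra.
  move=> _ [x /= xa <-]; rewrite -[x](subrK 1) fG.2.2 lerD2r.
  by apply: lift_le_leftlim; lra.
- rewrite -lerBrDr; apply: ge_sup; first by exists (f (a - 1)); exists (a - 1) => //=; lra.
  move=> _ [x /= xa <-]; rewrite lerBrDr -fG.2.2.
  by apply: lift_le_leftlim; lra.
Qed.

(* The witness consists of the points where [f] crosses a level [f 0 + k d]. *)
Lemma lift_grid (d : R) : 0 < d -> exists F : seq R,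
  [/\ uniq F, forall a, a \in F -> 0 < a <= 1 &
      forall s t, 0 <= s -> s <= t -> t <= 1 ->
        (forall a, a \in F -> ~~ (s < a <= t)) -> f t - f s <= d].
Proof.
move=> d0.
pose E (k : nat) := [set s | 0 <= s /\ f 0 + k%:R * d <= f s].
pose K := (Num.truncn ((f 1 - f 0) / d)).+1.
pose F := undup [seq a <- [seq inf (E k) | k <- iota 0 K] | 0 < a <= 1].
exists F; split; first exact: undup_uniq.
  by move=> a; rewrite mem_undup mem_filter => /andP[].
move=> s t s0 st t1 hF; rewrite leNgt; apply/negP => dst.
have fs0 : 0 <= (f s - f 0) / d by rewrite divr_ge0 ?(ltW d0)// subr_ge0 fG.1.
(* Index of the first level strictly above [f s]. It lies at most [d] higher, so it has been reached
   at [t]. *)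
pose k := (Num.truncn ((f s - f 0) / d)).+1.
have /andP[k1 k2] := truncn_itv fs0.
have {}k1 : f 0 + k%:R * d <= f s + d.
  have -> : k%:R * d = (Num.truncn ((f s - f 0) / d))%:R * d + d by rewrite /k mulrSr mulrDl mul1r.
  by move: k1; rewrite ler_pdivlMr//; lra.
have {}k2 : f s < f 0 + k%:R * d by move: k2; rewrite ltr_pdivrMr// -/k; lra.
have f10 : 0 <= (f 1 - f 0) / d by rewrite divr_ge0 ?(ltW d0)// subr_ge0 fG.1.
have kK : (k < K)%N.
  have /andP[_ kk] := truncn_itv f10.
  rewrite -(ltr_nat R) -(ltr_pM2r d0); apply: le_lt_trans (_ : f 1 - f 0 < _).
    by have := fG.1 _ _ t1; lra.
  by move: kk; rewrite ltr_pdivrMr.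
have tE : E k t by split; [exact: le_trans st|move: k1 dst; lra].
have sE : lbound (E k) s.
  by move=> x [_ hx]; rewrite leNgt; apply/negP => /ltW/fG.1; lra.
have hi : has_inf (E k) by split; [exists t|exists s].
have st' : inf (E k) <= t by apply: ge_inf => //; exists s.
have : s <= inf (E k) by apply: lb_le_inf => //; exists t.
(* A crossing at [s] itself would escape the half-open interval, but right continuity keeps [f]
   below the level just after [s], so the infimum cannot be [s]. *)
rewrite le_eqVlt => /orP[/eqP es|ss].
  have [r r0 hr] := @lift_right_cont s (f 0 + k%:R * d - f s) ltac:(lra).
  have [x [_ xE] xs] := inf_adherent r0 hi.
  have sx : s <= x by apply: sE; split => //; apply: le_trans s0 _; rewrite leNgt; apply/negP => /ltW/fG.1; lra.
  by have := hr x; rewrite sx es xs => /(_ isT); move: xE; lra.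
have aF : inf (E k) \in F.
  rewrite mem_undup mem_filter; apply/andP; split; first by apply/andP; split; lra.
  by apply/mapP; exists k => //; rewrite mem_iota.
by have := hF _ aF; rewrite ss st'.
Qed.

Definition node N i : R := i%:R / N%:R.

(** Open on the left, closed on the right: then [f] at the left node is at most the left limit at
    [a], and [f] at the right node is at least [f a], so the whole jump is crossed within the cell
    even if [a] is a node. *)
Definition cell N i a := node N i < a <= node N i.+1.

Lemma node_le N i j : (i <= j)%N -> node N i <= node N j.
Proof. by move=> ij; rewrite ler_wpM2r ?invr_ge0// ler_nat. Qed.

Lemma node_itv N i : (i <= N)%N -> 0 <= node N i <= 1.
Proof.
case: N => [|N] iN; first by rewrite /node invr0 mulr0 lexx ler01.
by rewrite divr_ge0//= ler_pdivrMr// mul1r ler_nat.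
Qed.

Lemma nodeS N i : node N i.+1 = node N i + N%:R^-1.
Proof. by rewrite /node -natr1 mulrDl mul1r. Qed.

Lemma cell_sum N (v : nat -> R) a : (0 < N)%N -> 0 < a <= 1 ->
  exists i, [/\ (i < N)%N, cell N i a &
    \sum_(j < N) (if cell N j a then v j else 0) = v i].
Proof.
move=> N0 /andP[a0 a1].
have ex : exists i, a <= node N i.+1 by exists N.-1; rewrite prednK// /node divff// pnatr_eq0 -lt0n.
case: (ex_minnP ex) => i ai imin.
have iN : (i < N)%N by rewrite -(prednK N0) ltnS imin// prednK// /node divff// pnatr_eq0 -lt0n.
have ci : cell N i a.
  rewrite /cell ai andbT; case: i {iN} ai imin => [|i] ai imin; first by rewrite /node mul0r.
  by rewrite ltNge; apply/negP => /imin; rewrite ltnn.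
exists i; split => //.
rewrite (bigD1 (Ordinal iN))//= ci big1 ?addr0// => j ji; case: ifP => // /andP[ja aj].
have := imin _ aj; rewrite leq_eqVlt => /orP[/eqP ij|ij].
  by move: ji; rewrite -val_eqE /= ij eqxx.
have := node_le N ij; move: ci => /andP[_ ci].
by rewrite leNgt (lt_le_trans ja ci).
Qed.

Lemma telescope_lift N : (0 < N)%N ->
  \sum_(i < N) (f (node N i.+1) - f (node N i)) = 1.
Proof.
move=> N0; rewrite -(big_mkord xpredT (fun i => f (node N i.+1) - f (node N i))) telescope_sumr//.
by rewrite /node divff ?pnatr_eq0 -?lt0n// mul0r -[X in f X]add0r fG.2.2; ring.
Qed.

Lemma uniq_separated (F : seq R) : uniq F ->
  exists2 r : R, 0 < r & forall a b, a \in F -> b \in F -> `|a - b| < r -> a = b.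
Proof.
elim: F => [_|x F IHF /= /andP[xF /IHF[r r0 hr]]]; first by exists 1.
have [q q0 hq] : exists2 q : R, 0 < q & forall a, a \in F -> q <= `|a - x|.
  elim: F xF {IHF hr} => [_|y F IHF]; first by exists 1.
  rewrite inE negb_or => /andP[xy /IHF[q q0 hq]].
  exists (Num.min q `|y - x|); first by rewrite lt_min q0 normr_gt0 subr_eq0 eq_sym.
  by move=> a; rewrite inE ge_min => /orP[/eqP->|/hq->//]; rewrite lexx orbT.
exists (Num.min r q); first by rewrite lt_min r0.
move=> a b; rewrite !inE lt_min => /orP[/eqP->|aF] /orP[/eqP->|bF] /andP[abr abq] //.
- by have := hq _ bF; rewrite leNgt distrC abq.
- by have := hq _ aF; rewrite leNgt abq.
- exact: hr.
Qed.

Lemma invr_nat_lt (r : R) : 0 < r -> exists N0, forall N, (N0 <= N)%N -> (0 < N)%N /\ N%:R^-1 < r.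
Proof.
move=> r0; exists (Num.truncn r^-1).+1 => N hN.
have N0 : (0 < N)%N by apply: leq_trans hN.
split => //; rewrite invf_plt ?posrE ?ltr0n//.
have ri0 : 0 <= r^-1 by rewrite invr_ge0 ltW.
by have /andP[_ /lt_le_trans->//] := truncn_itv ri0; rewrite ler_nat.
Qed.

Lemma cell_count_le1 (F : seq R) : uniq F -> exists N0, forall N, (N0 <= N)%N ->
  forall i, (count (cell N i) F <= 1)%N.
Proof.
move=> Fu; have [r r0 hr] := uniq_separated Fu; have [N0 hN] := invr_nat_lt r0.
exists N0 => N /hN[N1 Nr] i; rewrite leqNgt; apply/negP => c2.
have : (1 < size [seq a <- F | cell N i a])%N by rewrite size_filter.
have := filter_uniq (cell N i) Fu.
have sub := mem_filter (cell N i).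
case E : [seq a <- F | cell N i a] => [|a [|b l]]//= /andP[anb _] _.
have /andP[/andP[a1 a2] aF] : cell N i a && (a \in F) by rewrite -sub E mem_head.
have /andP[/andP[b1 b2] bF] : cell N i b && (b \in F) by rewrite -sub E !inE eqxx orbT.
have ab : a = b by apply: hr => //; rewrite nodeS in a2 b2; rewrite ltr_norml; lra.
by move: anb; rewrite ab mem_head.
Qed.

Lemma sum_cell_exchange N (F : seq R) (v : nat -> R) :
  \sum_(a <- F) \sum_(i < N) (if cell N i a then v i else 0) =
  \sum_(i < N) v i *+ count (cell N i) F.
Proof.
rewrite exchange_big /=; apply: eq_bigr => i _.
by rewrite -big_mkcond/= big_const_seq iter_addr_0.
Qed.

Definition gap a := f a - leftlim f a.

Lemma gap_ge0 a : 0 <= gap a.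
Proof. by rewrite subr_ge0 leftlim_le. Qed.

(** On a grid fine enough to separate the points of [F], each gap is at most the increment over its
    own cell, and the increments add up to 1. *)
Lemma sum_gap_le1 (F : seq R) : uniq F -> (forall a, a \in F -> 0 < a <= 1) ->
  \sum_(a <- F) gap a <= 1.
Proof.
move=> Fu F01; have [N0 /(_ (maxn N0 1) (leq_maxl _ _))] := cell_count_le1 Fu.
set N := maxn N0 1 => hN; have Np : (0 < N)%N by rewrite leq_maxr.
pose v i := f (node N i.+1) - f (node N i).
have v0 i : 0 <= v i by rewrite subr_ge0 fG.1// node_le.
apply: le_trans (_ : \sum_(a <- F) \sum_(i < N) (if cell N i a then v i else 0) <= _).
  rewrite big_seq [leRHS]big_seq; apply: ler_sum => a aF.
  have [i [_ /andP[ci1 ci2] ->]] := cell_sum v Np (F01 _ aF).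
  by rewrite lerB ?lift_le_leftlim// fG.1.
rewrite sum_cell_exchange -(telescope_lift Np); apply: ler_sum => i _.
rewrite -/(v i); have := hN i; case: (count _ _) => [|[|//]] _; first by rewrite mulr0n.
by rewrite mulr1n.
Qed.

(** Jumps are listed in [[0, 1[] while the cells cover []0, 1]]; by periodicity the point 0 may be
    replaced by 1. *)
Lemma sum_gap_le1_co (F : seq R) : uniq F -> (forall a, a \in F -> 0 <= a < 1) ->
  \sum_(a <- F) gap a <= 1.
Proof.
move=> Fu F01; pose w a := if a == 0 then 1 else a.
have -> : \sum_(a <- F) gap a = \sum_(a <- map w F) gap a.
  rewrite big_map; apply: eq_bigr => a _; rewrite /w; case: eqP => // ->.
  by rewrite /gap -(add0r 1) leftlimD1 fG.2.2; ring.
apply: sum_gap_le1.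
  rewrite map_inj_in_uniq// => a b /F01/andP[a0 a1] /F01/andP[b0 b1].
  rewrite /w; case: eqP => [->|_]; case: eqP => [->|_]// e; move: a1 b1; rewrite ?e -?e ltxx//.
move=> _ /mapP[a /F01/andP[a0 a1] ->]; rewrite /w.
case: eqP => [_|/eqP an]; first by rewrite ltr01 lexx.
by rewrite lt_neqAle eq_sym an a0 ltW.
Qed.

End Lift.

(** * Sums over jumps and Riemann sums *)

Section SignedSum.
Context {R : realType}.

(** Outside [F] the terms are dominated by [e * g], where [g] has total mass at most 1 on [J]; hence
    the remainder [r]. Points of [F] outside [J] are allowed because [w] vanishes there. *)
Lemma esum_tail (J : set R) (w g : R -> R) (F : seq R) (e : R) : uniq F -> 0 <= e ->
  (forall s : seq R, uniq s -> {in s, forall a, J a} -> \sum_(a <- s) g a <= 1) ->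
  (forall a, 0 <= w a) -> (forall a, J a -> a \notin F -> w a <= e * g a) ->
  (forall a, a \in F -> ~ J a -> w a = 0) ->
  exists2 r, 0 <= r <= e & (\esum_(a in J) (w a)%:E)%E = (\sum_(a <- F) w a + r)%:E.
Proof.
move=> Fu e0 g1 w0 wg wF.
rewrite (esumID [set` F]); last by move=> a _; rewrite lee_fin.
have -> : (\esum_(a in J `&` [set` F]) (w a)%:E = (\sum_(a <- F) w a)%:E)%E.
  rewrite esum_mkcondl esum_fset; [|exact: finite_seq|by move=> a _; case: ifP => // _; rewrite lee_fin].
  rewrite -fsbig_seq// -sumEFin big_seq [RHS]big_seq.
  apply: eq_bigr => a aF; case: ifPn => // aJ; rewrite (wF a)// => Ja.
  by case/negP: aJ; exact: mem_set.
set T := esum _ _.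
have T0 : (0 <= T)%E by apply: esum_ge0 => a _; rewrite lee_fin.
have Te : (T <= e%:E)%E.
  apply: ge_ereal_sup => _ [X [finX XJ] <-].
  rewrite fsbig_finite// sumEFin lee_fin.
  have XP a : a \in finmap.enum_fset (fset_set X) -> (J `&` ~` [set` F]) a.
    move=> aX; apply/XJ/set_mem; rewrite -(in_fset_set finX); exact: aX.
  apply: le_trans (_ : \sum_(a <- finmap.enum_fset (fset_set X)) e * g a <= _).
    rewrite big_seq [leRHS]big_seq; apply: ler_sum => a /XP[Ja /= /negP aF].
    exact: wg.
  rewrite -mulr_sumr -[leRHS]mulr1 ler_wpM2l// g1//; first exact: finmap.fset_uniq.
  by move=> a /XP[].
have Tfin : T \is a fin_num by rewrite ge0_fin_numE// (le_lt_trans Te) ?ltry.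
exists (fine T); first by rewrite fine_ge0//= -lee_fin fineK.
by rewrite EFinD fineK.
Qed.

(** The positive and the negative part each leave a remainder in [[0, e]], so their difference is
    still within [e]. *)
Lemma ssum_approx (J : set R) (v g : R -> R) (F : seq R) (e : R) : uniq F -> 0 <= e ->
  (forall a, J a -> 0 <= g a) ->
  (forall s : seq R, uniq s -> {in s, forall a, J a} -> \sum_(a <- s) g a <= 1) ->
  (forall a, J a -> a \notin F -> `|v a| <= e * g a) ->
  (forall a, a \in F -> ~ J a -> v a = 0) ->
  `|ssum J v - \sum_(a <- F) v a| <= e.
Proof.
move=> Fu e0 g0 g1 vg vF; rewrite /ssum.
have [|||p p01 ->] := @esum_tail J (fun a => Num.max (v a) 0) g F e Fu e0 g1.
- by move=> a; rewrite le_max lexx orbT.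
- move=> a Ja aF; rewrite ge_max mulr_ge0 ?g0// andbT.
  by apply: le_trans (vg _ Ja aF); rewrite ler_norm.
- by move=> a aF Ja; rewrite vF// maxxx.
have [|||n n01 ->] := @esum_tail J (fun a => Num.max (- v a) 0) g F e Fu e0 g1.
- by move=> a; rewrite le_max lexx orbT.
- move=> a Ja aF; rewrite ge_max mulr_ge0 ?g0// andbT.
  by apply: le_trans (vg _ Ja aF); rewrite -normrN ler_norm.
- by move=> a aF Ja; rewrite vF// oppr0 maxxx.
have -> : \sum_(a <- F) v a =
    \sum_(a <- F) Num.max (v a) 0 - \sum_(a <- F) Num.max (- v a) 0.
  rewrite -sumrB; apply: eq_bigr => a _.
  by rewrite /Num.max; case: ifPn; case: ifPn; lra.
rewrite /= ler_norml; lra.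
Qed.

End SignedSum.

Section Riemann.
Context {R : realType} (u : R -> R) (B : R).
Hypothesis um : measurable_fun setT u.
Hypothesis uB : forall s, `|u s| <= B.
Local Notation mu := (@lebesgue_measure R).

Lemma bounded_integrable_itv b1 b2 (a b : R) : mu.-integrable [set` Interval (BSide b1 a) (BSide b2 b)] (EFin \o u).
Proof.
apply: measurable_bounded_integrable => //; last 2 first.
- exact: measurable_funS um.
- by exists B; split; [exact: num_real|move=> M BM s _ /=; apply: le_trans (uB s) _; exact: ltW].
by rewrite /= lebesgue_measure_itv/=; case: ifP => // _; rewrite -EFinB ltry.
Qed.

Lemma Rintegral_near_cst (a b c w : R) : a <= b -> (forall s, a <= s <= b -> `|c - u s| <= w) ->
  `|c * (b - a) - \int[mu]_(s in `]a, b]) u s| <= w * (b - a).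
Proof.
move=> ab hc.
have mab : fine (mu `]a, b]) = b - a.
  rewrite lebesgue_measure_itv/= lte_fin; case: ltP => //= ba; lra.
have ci r : mu.-integrable `]a, b] (EFin \o cst r).
  apply: measurable_bounded_integrable => //.
    by rewrite /= lebesgue_measure_itv/=; case: ifP => // _; rewrite -EFinB ltry.
  by exists `|r|; split; [exact: num_real|move=> M rM s _ /=; exact: ltW].
have up : \int[mu]_(s in `]a, b]) u s <= (c + w) * (b - a).
  rewrite -mab -(Rintegral_cst mu) //; apply: le_Rintegral => //; [exact: bounded_integrable_itv|exact: ci|].
  move=> s /=; rewrite in_itv /= => /andP[/ltW as_ sb].
  by have := hc s; rewrite as_ sb => /(_ isT); rewrite ler_norml; lra.
have low : (c - w) * (b - a) <= \int[mu]_(s in `]a, b]) u s.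
  rewrite -mab -(Rintegral_cst mu) //; apply: le_Rintegral => //; [exact: ci|exact: bounded_integrable_itv|].
  move=> s /=; rewrite in_itv /= => /andP[/ltW as_ sb].
  by have := hc s; rewrite as_ sb => /(_ isT); rewrite ler_norml; lra.
set I : R := Rintegral mu _ u in up low *; clearbody I; clear -up low.
by rewrite ler_norml; lra.
Qed.

(** The oscillations enter only through their sum. For a function of bounded variation the error is
    therefore of order [1 / N] without any continuity, and the jumps of [g] do no harm. *)
Lemma riemann_sum (N : nat) (c w : nat -> R) : (0 < N)%N ->
  (forall i s, node N i <= s <= node N i.+1 -> `|c i - u s| <= w i) ->
  `|N%:R^-1 * \sum_(i < N) c i - \int[mu]_(s in `[0, 1]) u s| <= N%:R^-1 * \sum_(i < N) w i.
Proof.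
move=> N0 hc.
have ind k : `|N%:R^-1 * \sum_(i < k) c i - \int[mu]_(s in `[0, node N k]) u s| <=
    N%:R^-1 * \sum_(i < k) w i.
  elim: k => [|k IHk].
    by rewrite !big_ord0 !mulr0 /node mul0r set_itv1 Rintegral_set1 subrr normr0.
  have nk : (node N k : R) <= node N k.+1 := node_le _ (leqnSn k).
  have n0 : 0 <= (node N k : R) by rewrite divr_ge0.
  have := @Rintegral_itvB _ u (BLeft 0) (BRight (node N k.+1)) (node N k) (bounded_integrable_itv _ _ _ _).
  rewrite !bnd_simp => /(_ n0 nk) e.
  have := Rintegral_near_cst nk (hc k); rewrite -e {1 3}nodeS => h.
  rewrite !big_ord_recr /= !mulrDr.
  move: IHk h; rewrite !ler_norml !(mulrC _ (_ - node N k)) (addrC (node N k)) addrK.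
  lra.
have := ind N; rewrite /node divff//; by rewrite pnatr_eq0 -lt0n.
Qed.

End Riemann.

(** * Convergence of the defect sums over cells to the sum over jumps *)

Section DefectSums.
Context {R : realType} (h hinv : R -> R).
Hypothesis hG : isGlift h.
Hypothesis hC2 : isC2 h.
Hypothesis hinvC2 : isC2 hinv.
Hypothesis hK : cancel h hinv.

(** The chord over a union of adjacent intervals is the weighted mean of the two chords. Its change
    is thus their difference times the fraction of added length, and both are values of [h'] within
    the long interval. *)
Lemma chord_lip (K : R) : 0 < K ->
  (forall x y, `|derive1 h x - derive1 h y| <= K * `|x - y|) ->
  (forall x y y', x <= y -> y <= y' -> `|chord h x y' - chord h x y| <= K * (y' - y)) /\
  (forall x' x y, x' <= x -> x <= y -> `|chord h x' y - chord h x y| <= K * (x - x')).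
Proof.
move=> K0 lip.
have near a b c d l r : l <= a <= b -> b <= r -> l <= c <= d -> d <= r ->
    `|chord h a b - chord h c d| <= K * (r - l).
  move=> /andP[la ab] br /andP[lc cd] dr.
  have [z /andP[az zb] ->] := chord_mvt hC2 ab; have [z' /andP[cz' zd'] ->] := chord_mvt hC2 cd.
  by apply: le_trans (lip _ _) _; rewrite ler_pM2l// ler_norml; lra.
split.
- move=> x y y' xy yy'; have [->|yny'] := eqVneq y y'; first by rewrite !subrr normr0 mulr0.
  have yy : 0 < y' - y by rewrite subr_gt0 lt_neqAle yny'.
  have p : 0 < y' - x by lra.
  have e : (chord h x y' - chord h x y) * (y' - x) = (chord h y y' - chord h x y) * (y' - y).
    rewrite !mulrBl !chord_mul (_ : y' - x = (y' - y) + (y - x)); last by ring.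
    by rewrite mulrDr chord_mul; ring.
  rewrite -(ler_pM2r p) -{1}(gtr0_norm p) -normrM e normrM (gtr0_norm yy) mulrAC.
  rewrite ler_pM2r//; apply: near; rewrite ?lexx ?xy//; lra.
- move=> x' x y xx' xy; have [->|xnx'] := eqVneq x' x; first by rewrite !subrr normr0 mulr0.
  have xx : 0 < x - x' by rewrite subr_gt0 lt_neqAle xnx'.
  have p : 0 < y - x' by lra.
  have e : (chord h x' y - chord h x y) * (y - x') = (chord h x' x - chord h x y) * (x - x').
    rewrite !mulrBl !chord_mul (_ : y - x' = (y - x) + (x - x')); last by ring.
    by rewrite mulrDr chord_mul; ring.
  rewrite -(ler_pM2r p) -{1}(gtr0_norm p) -normrM e normrM (gtr0_norm xx) mulrAC.
  rewrite ler_pM2r//; apply: near; rewrite ?lexx ?xy//; lra.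
Qed.

(** Nested intervals suffice: the values of [f] at the ends of a cell enclose its two one-sided
    limits at a jump in that cell. Moving one endpoint changes half of a term [ln h'] and the term
    [ln chord], whence a constant below [2 * (m^-1 * K)]. *)
Lemma defect_lip : exists2 C : R, 0 < C & forall x' x y y', x' <= x -> x <= y -> y <= y' ->
  `|defect h x' y' - defect h x y| <= C * ((x - x') + (y' - y)).
Proof.
have [m [K [m0 K0 b lip]]] := derive1_diffeo_bounds hG hC2 hinvC2 hK.
have [cr cl] := chord_lip K0 lip.
have lnl (a c : R) : m <= a -> m <= c -> `|ln a - ln c| <= m^-1 * `|a - c|.
  have half (p q : R) : m <= p -> m <= q -> ln p - ln q <= m^-1 * `|p - q|.
    move=> mp mq; have p0 := lt_le_trans m0 mp; have q0 := lt_le_trans m0 mq.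
    apply: le_trans (ln_diff_le p0 q0) _.
    apply: le_trans (_ : (p - q) / q <= `|p - q| / q) _; first by rewrite ler_pM2r ?invr_gt0// ler_norm.
    by rewrite mulrC ler_wpM2r// lef_pV2 ?posrE.
  move=> ma mc; rewrite ler_norml lerNl opprB half// andbT.
  by rewrite distrC half.
have mch x y : x <= y -> m <= chord h x y.
  by move=> /(chord_mvt hC2)[z _ ->]; have /andP[] := b z.
have mi0 : 0 < m^-1 by rewrite invr_gt0.
exists (2 * (m^-1 * K)); first by rewrite !mulr_gt0.
move=> x' x y y' xx xy yy; rewrite /defect.
have x'y : x' <= y by lra. have x'y' : x' <= y' by lra. have xy' : x <= y' by lra.
have l1 : `|ln (derive1 h x') - ln (derive1 h x)| <= m^-1 * (K * (x - x')).
  apply: le_trans (lnl _ _ _ _) _; [by have /andP[] := b x'|by have /andP[] := b x|].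
  by rewrite ler_pM2l//; apply: le_trans (lip _ _) _; rewrite distrC ger0_norm ?subr_ge0.
have l2 : `|ln (derive1 h y') - ln (derive1 h y)| <= m^-1 * (K * (y' - y)).
  apply: le_trans (lnl _ _ _ _) _; [by have /andP[] := b y'|by have /andP[] := b y|].
  by rewrite ler_pM2l//; apply: le_trans (lip _ _) _; rewrite ger0_norm ?subr_ge0.
have l3 : `|ln (chord h x' y') - ln (chord h x' y)| <= m^-1 * (K * (y' - y)).
  apply: le_trans (lnl _ _ _ _) _; [exact: mch..|].
  by rewrite ler_pM2l// cr.
have l4 : `|ln (chord h x' y) - ln (chord h x y)| <= m^-1 * (K * (x - x')).
  apply: le_trans (lnl _ _ _ _) _; [exact: mch..|].
  by rewrite ler_pM2l// cl.
set p := m^-1 * (K * (x - x')) in l1 l4; set q := m^-1 * (K * (y' - y)) in l2 l3.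
have -> : 2 * (m^-1 * K) * ((x - x') + (y' - y)) = 2 * (p + q) by rewrite /p /q; ring.
have p0 : 0 <= p by apply: le_trans l1.
have q0 : 0 <= q by apply: le_trans l2.
move: l1 l2 l3 l4; clearbody p q; clear -p0 q0; rewrite !ler_norml.
move: (ln (derive1 h x')) (ln (derive1 h x)) (ln (derive1 h y')) (ln (derive1 h y))
  (ln (chord h x' y')) (ln (chord h x' y)) (ln (chord h x y)) => a' a b' b c' d c.
lra.
Qed.

Variable f : R -> R.
Hypothesis fG : isGlift f.

Let jump_defect a := defect h (leftlim f a) (f a).

Lemma jump_defect_frac a : jump_defect (if a == 1 then 0 else a) = jump_defect a.
Proof.
rewrite /jump_defect; case: eqP => [->|//].
rewrite -(add0r 1) leftlimD1// fG.2.2 -[X in _ = defect h (_ + X) _]/(1%:~R).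
by rewrite -[X in _ = defect h _ (_ + X)]/(1%:~R) defectDz.
Qed.

Let cell_defect N i := defect h (f (node N i)) (f (node N i.+1)).

(** As the cell around [a] shrinks, the value of [f] at its left node tends to the left limit and
    the one at its right node to [f a]; [defect_lip] turns this into convergence of the defects. *)
Lemma cell_defect_cvg (a e : R) : 0 < a <= 1 -> 0 < e -> exists N0, forall N, (N0 <= N)%N ->
  `|\sum_(i < N) (if cell N i a then cell_defect N i else 0) - jump_defect a| <= e.
Proof.
move=> a01 e0; have [C C0 hC] := defect_lip.
have e20 : 0 < e / (2 * C) by rewrite divr_gt0// mulr_gt0.
have [r1 r10 h1] := lift_right_cont fG a e20.
have [r2 r20 h2] := lift_left_lim fG a e20.
have r0 : 0 < Num.min r1 r2 by rewrite lt_min r10.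
have [N0 hN] := invr_nat_lt r0; exists N0 => N /hN[N1]; rewrite lt_min => /andP[Nr1 Nr2].
have [i [_ ci ->]] := cell_sum (cell_defect N) N1 a01.
move: ci; rewrite /cell nodeS => /andP[ia ai].
have le1 := lift_le_leftlim fG ia.
apply: le_trans (hC _ _ _ _ le1 _ _) _; [exact: leftlim_le|by rewrite nodeS fG.1|].
have -> : e = C * (e / (2 * C) + e / (2 * C)) by field; rewrite gt_eqF.
rewrite ler_pM2l// lerD//.
  have hr : a - r2 <= node N i by lra.
  by have := h2 _ hr ia; lra.
have hr : a <= node N i.+1 < a + r1 by rewrite nodeS; lra.
by have := h1 _ hr; lra.
Qed.

Lemma cell_defect_sum_cvg (F : seq R) (e : R) : (forall a, a \in F -> 0 < a <= 1) -> 0 < e ->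
  exists N0, forall N, (N0 <= N)%N ->
  `|\sum_(a <- F) \sum_(i < N) (if cell N i a then cell_defect N i else 0)
    - \sum_(a <- F) jump_defect a| <= e.
Proof.
elim: F e => [|a F IHF] e hF e0; first by exists 0%N => N _; rewrite !big_nil subrr normr0 ltW.
have [|N1 h1] := @cell_defect_cvg a (e / 2) (hF _ (mem_head _ _)); first lra.
have [||N2 h2] := IHF (e / 2); first by move=> b bF; apply: hF; rewrite inE bF orbT.
  lra.
exists (maxn N1 N2) => N; rewrite geq_max => /andP[/h1 {}h1 /h2 {}h2].
rewrite !big_cons; move: h1 h2; rewrite !ler_norml; lra.
Qed.

Let J := [set a | 0 <= a < 1 /\ leftlim f a < f a].

(** Three errors of size [e / 3], for a finite set [F] outside which [f] moves little: cells without
    a point of [F] have small increments, so their defects are [e / 3] times increments of total 1;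
    cells with a point of [F] converge one by one; jumps outside [F] are small and their gaps add up
    to at most 1. *)
Lemma defect_sum_cvg (e : R) : 0 < e -> exists N0, forall N, (N0 <= N)%N ->
  `|\sum_(i < N) cell_defect N i - ssum J jump_defect| <= e.
Proof.
move=> e0; have e30 : 0 < e / 3 by lra.
have [d d0 hd] := defect_littleo hG hC2 hinvC2 hK e30.
(* Halving turns the weak bound of [lift_grid] into the strict one that [defect_littleo] needs. *)
have d20 : 0 < d / 2 by lra.
have [F [Fu F01 Fd]] := lift_grid fG d20.
(* [F] lies in []0, 1]] but the jumps are listed in [[0, 1[]; [w] identifies 1 with 0, and [a']
   below goes the other way. *)
pose w a : R := if a == 1 then 0 else a.
have wF : uniq (map w F).
  rewrite map_inj_in_uniq// => a b /F01/andP[a0 a1] /F01/andP[b0 b1].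
  rewrite /w; case: eqP => [->|_]; case: eqP => [->|_]// ab; move: a0 b0; rewrite ?ab -?ab ltxx//.
have wF01 a : a \in map w F -> 0 <= a < 1.
  move=> /mapP[b /F01/andP[b0 b1] ->]; rewrite /w; case: eqP => [_|/eqP bn1]; first by rewrite lexx ltr01.
  by rewrite ltW//= lt_neqAle bn1.
have sF : \sum_(a <- F) jump_defect a = \sum_(a <- map w F) jump_defect a.
  by rewrite big_map; apply: eq_bigr => a _; rewrite jump_defect_frac.
have ss : `|ssum J jump_defect - \sum_(a <- map w F) jump_defect a| <= e / 3.
  apply: (@ssum_approx _ J jump_defect (gap f)) => //.
  - exact: ltW.
  - by move=> a _; exact: gap_ge0.
  - by move=> s su sJ; apply: sum_gap_le1_co => // a /sJ[].
  - move=> a [/andP[a0 a1] _] aF; apply: hd; first exact: leftlim_le.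
    pose a' : R := if a == 0 then 1 else a.
    have -> : f a - leftlim f a = f a' - leftlim f a'.
      by rewrite /a'; case: eqP => [->|//]; rewrite -(add0r 1) leftlimD1// fG.2.2; ring.
    have a'01 : 0 < a' <= 1.
      rewrite /a'; case: eqP => [_|/eqP an0]; first by rewrite ltr01 lexx.
      by rewrite lt_neqAle eq_sym an0 a0 ltW.
    have a'F : a' \notin F.
      apply: contra aF => a'F; apply/mapP; exists a' => //; rewrite /w /a'.
      by case: (eqVneq a 0) => [->|an0]; rewrite ?eqxx// lt_eqF.
    (* No point of [F] lies in []a' - r, a'[], so [f] moves by at most [d / 2] up to [a'], which
       bounds the gap there. *)
    have [r r0 hr] : exists2 r : R, 0 < r & forall b, b \in F -> b < a' -> b <= a' - r.
      elim: F {Fu F01 Fd wF wF01 sF aF a'F} => [|x F [r r0 hr]]; first by exists 1.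
      case: (ltP x a') => xa; last first.
        exists r => // b; rewrite inE => /orP[/eqP ->|]; last exact: hr.
        by rewrite ltNge xa.
      exists (Num.min r (a' - x)); first by rewrite lt_min r0 subr_gt0.
      move=> b; rewrite inE => /orP[/eqP -> _|bF ba].
        by have : Num.min r (a' - x) <= a' - x by [rewrite ge_min lexx orbT]; lra.
      by have := hr _ bF ba; have : Num.min r (a' - x) <= r by [rewrite ge_min lexx]; lra.
    pose s := Num.max 0 (a' - r).
    have /andP[a'0 a'1] := a'01.
    have sa : s < a' by rewrite /s gt_max a'0 /=; lra.
    have := Fd s a'; rewrite le_max lexx (ltW sa) => /(_ isT isT a'1) => hs.
    have : f a' - f s <= d / 2.
      apply: hs => b bF; apply/negP => /andP[sb]; rewrite le_eqVlt => /orP[/eqP ba|/(hr _ bF)].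
        by move: a'F; rewrite -ba bF.
      by move: sb; rewrite /s gt_max; lra.
    by have := lift_le_leftlim fG sa; lra.
  - move=> a /wF01 a01 /not_andP[//|/negP]; rewrite -leNgt => fl.
    rewrite /jump_defect (_ : f a = leftlim f a) ?defectxx//.
    by apply/eqP; rewrite eq_le fl leftlim_le.
have [N1 h1] := cell_count_le1 Fu.
have [N2 h2] := cell_defect_sum_cvg F01 e30.
exists (maxn 1 (maxn N1 N2)) => N; rewrite !geq_max => /and3P[N0 /h1 {}h1 /h2 {}h2].
have : `|\sum_(i < N) cell_defect N i
    - \sum_(a <- F) \sum_(i < N) (if cell N i a then cell_defect N i else 0)| <= e / 3.
  rewrite (sum_cell_exchange _ _ (cell_defect N)) -sumrB.
  apply: le_trans (ler_norm_sum _ _ _) _.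
  have -> : e / 3 = e / 3 * \sum_(i < N) (f (node N i.+1) - f (node N i)).
    by rewrite telescope_lift// mulr1.
  rewrite mulr_sumr; apply: ler_sum => i _.
  have nn : (node N i : R) <= node N i.+1 := node_le _ (leqnSn i).
  have ff : f (node N i) <= f (node N i.+1) by rewrite fG.1.
  have := h1 i; case E : (count _ _) => [|[|//]] _; last first.
    by rewrite mulr1n subrr normr0 mulr_ge0// ?(ltW e30)// subr_ge0.
  rewrite mulr0n subr0; apply: hd => //; apply: le_lt_trans (_ : d / 2 < d); last lra.
  have /andP[n0 _] : 0 <= (node N i : R) <= 1 := node_itv (ltnW (ltn_ord i)).
  have /andP[_ n1] : 0 <= (node N i.+1 : R) <= 1 := node_itv (ltn_ord i).
  apply: Fd => // a aF; apply/negP => ca.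
  have : (0 < count (cell N i) F)%N by rewrite -has_count; apply/hasP; exists a.
  by rewrite E.
move: h2 ss; rewrite sF !ler_norml; lra.
Qed.

End DefectSums.

(** * Pointwise convergence of the densities *)

Section Marginals.
Context {R : realType}.

Lemma arc_frac (x y : R) : arc (frac x) (frac y) = frac (y - x).
Proof.
rewrite /arc (_ : frac y - frac x = y - x + (Num.floor x - Num.floor y)%:~R) ?fracDz//.
by rewrite /frac intrD mulrNz; ring.
Qed.

Lemma arc_ge0 (x y : R) : 0 <= arc x y.
Proof. by have /andP[] := frac_itv (y - x). Qed.

Lemma evG_nxt (g : Gty R) N i : (i < N)%N -> evG (node N (nxt N i)) g = frac (sval g (node N i.+1)).
Proof.
move=> iN; rewrite /nxt; case: eqP => [<-|//].
have /asboolP[[_ [_ g1]] _] := svalP g.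
have -> : node i.+1 i.+1 = 0 + 1 :> R by rewrite /node divff ?pnatr_eq0// add0r.
by rewrite g1 -[X in _ = frac (_ + X)]/(1%:~R) fracDz /evG /node mul0r.
Qed.

(* Density of the law of [hinv \o g] at the nodes with respect to that of [g], as a function of the values of [g] at the nodes. If all these values coincide then some increment of the lift of [g] is [1], which is invisible to [arc]. *)
Definition Ynode (beta : R) (h : R -> R) (N : nat) (x : nat -> R) : R :=
  if \sum_(i < N) arc (x i) (x (nxt N i)) == 0 then
    derive1 h (x 0%N) `^ (beta + 1 - beta / N%:R)
  else \prod_(i < N) (chord h (x i) (x i + arc (x i) (x (nxt N i))) `^ (beta / N%:R - 1)
                      * derive1 h (x i)).

End Marginals.

Section Pointwise.
Context {R : realType} (beta : R) (h hinv : R -> R).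
Hypothesis beta0 : 0 < beta.
Hypothesis hG : isGlift h.
Hypothesis hC2 : isC2 h.
Hypothesis hinvC2 : isC2 hinv.
Hypothesis hK : cancel h hinv.

Variable g : Gty R.
Let f := sval g.

Lemma Gty_lift : isGlift (sval g).
Proof. by have /asboolP[] := svalP g. Qed.

Let fG : isGlift f := Gty_lift.

Let lnY N := beta / N%:R * \sum_(i < N) ln (chord h (f (node N i)) (f (node N i.+1)))
  + \sum_(i < N) defect h (f (node N i)) (f (node N i.+1)).

Let u x := ln (derive1 h x).

Lemma derive1_frac x : derive1 h (frac x) = derive1 h x.
Proof. by apply: periodic_frac; exact: derive1_diffeo_periodic. Qed.

Lemma node_incr N i : f (node N i) <= f (node N i.+1).
Proof. by apply: fG.1; exact: node_le. Qed.

Lemma nodeN N : (0 < N)%N -> f (node N N) = f (node N 0) + 1.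
Proof.
by move=> N0; rewrite /node divff ?pnatr_eq0 -?lt0n// mul0r -fG.2.2 add0r.
Qed.

(** The chord over a full period is 1 and all other chords equal [h'] at the common value. The
    Riemann part thus contributes the exponent [beta * (N - 1) / N], and the defect of the full turn
    contributes 1, which explains the exceptional branch of [Ynode]. *)
Lemma Ynode_unit_jump N j : (j < N)%N -> f (node N j.+1) = f (node N j) + 1 ->
  Ynode beta h N (fun i => evG (node N i) g) = expR (lnY N).
Proof.
move=> jN ej; have N0 : (0 < N)%N by apply: leq_trans jN.
have l i : (i <= j)%N -> f (node N i) = f (node N 0).
  move=> ij; apply/eqP; rewrite eq_le; apply/andP; split; last by apply/fG.1/node_le.
  have : f (node N i) <= f (node N j) by apply/fG.1/node_le.
  have : f (node N j.+1) <= f (node N N) by apply/fG.1/node_le.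
  by rewrite nodeN// ej; lra.
have r i : (j < i)%N -> (i <= N)%N -> f (node N i) = f (node N 0) + 1.
  move=> ji iN; apply/eqP; rewrite eq_le; apply/andP; split.
    by rewrite -nodeN//; apply/fG.1/node_le.
  by rewrite -(l j)// -ej; apply/fG.1/node_le.
have fr i : (i <= N)%N -> frac (f (node N i)) = frac (f (node N 0)).
  case: (leqP i j) => [/l->//|ji iN]; rewrite r//.
  by rewrite -[X in frac (_ + X)]/(1%:~R) fracDz.
have u1 i : (i <= N)%N -> u (f (node N i)) = u (f (node N 0)).
  by move=> iN; rewrite /u -derive1_frac fr// derive1_frac.
rewrite /Ynode big1 ?eqxx; last first.
  move=> i _; rewrite evG_nxt ?ltn_ord// /evG -/f (fr i.+1) ?ltn_ord// (fr i) 1?ltnW//.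
  by rewrite /arc subrr frac_id// lexx ltr01.
have d0 : 0 < derive1 h (evG (node N 0) g) := derive1_diffeo_gt0 hG hC2 hinvC2 hK _.
rewrite /powR gt_eqF//; congr expR; rewrite /evG derive1_frac -/(u _) -/f.
rewrite /lnY (bigD1 (Ordinal jN))//= [X in _ = _ + X](bigD1 (Ordinal jN))//= ej.
have one : chord h (f (node N j)) (f (node N j) + 1) = 1.
  rewrite /chord hG.2.2 addrAC subrr add0r addrAC subrr add0r divr1.
  by rewrite -subr_eq0 opprD addrA subrr add0r oppr_eq0 oner_eq0.
have -> : defect h (f (node N j)) (f (node N j) + 1) = u (f (node N 0)).
  rewrite /defect one ln1 subr0 (derive1_diffeo_periodic hG) -/(u _) u1 1?ltnW//; lra.
rewrite one ln1 add0r.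
have same i : (i < N)%N -> i != j -> f (node N i.+1) = f (node N i).
  move=> iN ij; case: (ltngtP i j) ij => // ij _; first by rewrite !l// ltnW.
  by rewrite (r i.+1 (leqW ij) iN) (r i ij (ltnW iN)).
rewrite [X in _ = _ + (_ + X)]big1 ?addr0; last first.
  by move=> i ij; rewrite same ?ltn_ord ?defectxx//.
rewrite (eq_bigr (fun=> u (f (node N 0)))); last first.
  move=> i ij; rewrite same ?ltn_ord//.
  by rewrite /chord eqxx -/(u _) u1// ltnW.
rewrite sumr_const (_ : #|_| = N.-1); last first.
  by rewrite cardC1 card_ord.
have eN : N%:R = N.-1%:R + 1 :> R by rewrite natr1 prednK.
have nz : N.-1%:R + 1 != 0 :> R by rewrite -eN pnatr_eq0 -lt0n.
by rewrite eN -[_ *+ N.-1]mulr_natr; field.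
Qed.

Lemma Ynode_lnY N : (0 < N)%N ->
  Ynode beta h N (fun i => evG (node N i) g) = expR (lnY N).
Proof.
move=> N0.
case: (pselect (exists2 j, (j < N)%N & f (node N j.+1) = f (node N j) + 1)) => [[j]|nj].
  exact: Ynode_unit_jump.
have i1 i : (i < N)%N -> f (node N i.+1) - f (node N i) < 1.
  move=> iN; rewrite lt_neqAle; apply/andP; split.
    by apply/eqP => e; apply: nj; exists i => //; rewrite -e; ring.
  have : f (node N i.+1) <= f (node N N) by apply/fG.1/node_le.
  have : f (node N 0) <= f (node N i) by apply/fG.1/node_le.
  by rewrite nodeN//; lra.
have arcE i : (i < N)%N -> arc (evG (node N i) g) (evG (node N (nxt N i)) g) =
    f (node N i.+1) - f (node N i).
  by move=> iN; rewrite evG_nxt// arc_frac frac_id// subr_ge0 node_incr i1.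
rewrite /Ynode (eq_bigr (fun i : 'I_N => f (node N i.+1) - f (node N i))); last first.
  by move=> i _; rewrite arcE.
rewrite telescope_lift// oner_eq0.
have chE i : (i < N)%N -> chord h (evG (node N i) g)
    (evG (node N i) g + arc (evG (node N i) g) (evG (node N (nxt N i)) g)) =
    chord h (f (node N i)) (f (node N i.+1)).
  move=> iN; rewrite arcE// /evG /frac -/f -mulrNz.
  rewrite (_ : _ + _ + (_ - _) = f (node N i.+1) + (- Num.floor (f (node N i)))%:~R); last by ring.
  exact: chordDz.
rewrite (eq_bigr (fun i : 'I_N => expR ((beta / N%:R - 1) *
    ln (chord h (f (node N i)) (f (node N i.+1))) + u (f (node N i))))); last first.
  move=> i _; have c0 := chord_gt0 hG hC2 hinvC2 hK (node_incr N i).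
  rewrite (chE i (ltn_ord i)) /powR (gt_eqF c0).
  rewrite expRD; congr (_ * _); rewrite /u lnK ?derive1_frac// posrE.
  exact: derive1_diffeo_gt0 hG hC2 hinvC2 hK _.
rewrite -expR_sum; congr expR; rewrite big_split /= -mulr_sumr /lnY.
(* [Ynode] weighs left ends only, the defects weigh both ends by one half; the discrepancy
   telescopes around the circle and vanishes by periodicity of [h']. *)
have tel : \sum_(i < N) (u (f (node N i.+1)) - u (f (node N i))) = 0.
  rewrite -(big_mkord xpredT (fun i => u (f (node N i.+1)) - u (f (node N i)))) telescope_sumr//.
  by rewrite nodeN// /u (derive1_diffeo_periodic hG) subrr.
have -> : \sum_(i < N) defect h (f (node N i)) (f (node N i.+1)) =
    \sum_(i < N) u (f (node N i)) - \sum_(i < N) ln (chord h (f (node N i)) (f (node N i.+1)))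
    + 2^-1 * \sum_(i < N) (u (f (node N i.+1)) - u (f (node N i))).
  rewrite mulr_sumr -sumrB -big_split /=; apply: eq_bigr => i _.
  by rewrite /defect -!/(u _); lra.
by rewrite tel; ring.
Qed.

Lemma lnY_bound (L : R) : (forall x y, x <= y -> `|ln (chord h x y)| <= L) ->
  (forall x y, x <= y -> `|defect h x y| <= L * (y - x)) ->
  forall N, (0 < N)%N -> `|lnY N| <= beta * L + L.
Proof.
move=> bc bd N N0; apply: le_trans (ler_normD _ _) _; apply: lerD.
  rewrite normrM ger0_norm ?divr_ge0 ?(ltW beta0)// -mulrA ler_pM2l//.
  rewrite mulrC ler_pdivrMr ?ltr0n//; apply: le_trans (ler_norm_sum _ _ _) _.
  apply: le_trans (_ : \sum_(i < N) L <= _).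
    by apply: ler_sum => i _; apply: bc; exact: node_incr.
  by rewrite sumr_const card_ord mulr_natr.
apply: le_trans (ler_norm_sum _ _ _) _.
rewrite -[leRHS]mulr1 -[X in _ <= _ * X](telescope_lift fG N0) mulr_sumr.
by apply: ler_sum => i _; apply: bd; exact: node_incr.
Qed.

Lemma Yb_expR : Yb beta h g = expR (beta * \int[lebesgue_measure]_(s in `[0, 1]) u (f s)
  + ssum [set a | 0 <= a < 1 /\ leftlim f a < f a] (fun a => defect h (leftlim f a) (f a))).
Proof.
rewrite /Yb /Xb /Y0 -expRD; congr (expR (_ + _)).
have e a : jumps g a -> ln (Yfactor h g a) = defect h (leftlim f a) (f a).
  move=> [_ la]; rewrite /Yfactor -/f /defect /chord lt_eqF//.
  have p1 : 0 < derive1 h (leftlim f a) by exact: derive1_diffeo_gt0 hG hC2 hinvC2 hK _.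
  have p2 : 0 < derive1 h (f a) by exact: derive1_diffeo_gt0 hG hC2 hinvC2 hK _.
  have p3 : 0 < (h (f a) - h (leftlim f a)) / (f a - leftlim f a).
    by rewrite divr_gt0// subr_gt0// (diffeo_lt hG hK).
  rewrite [X in X = _]ln_div ?posrE ?sqrtr_gt0//; last exact: mulr_gt0.
  set P := _ * _; have P0 : 0 < P by rewrite mulr_gt0.
  have -> : ln (Num.sqrt P) = (ln (derive1 h (leftlim f a)) + ln (derive1 h (f a))) / 2.
    rewrite -lnM ?posrE// -/P -[in RHS](sqr_sqrtr (ltW P0)) expr2 lnM ?posrE ?sqrtr_gt0//; lra.
  by [].
by rewrite /ssum; congr (fine _ - fine _); apply: eq_esum => a aJ; rewrite e.
Qed.

Lemma Ynode_cvg : Ynode beta h N (fun i => evG (node N i) g) @[N --> \oo] --> Yb beta h g.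
Proof.
have [L L0 [Lu Lc Lcu Ld]] := ln_chord_bounds hG hC2 hinvC2 hK.
rewrite Yb_expR.
have e : \forall N \near \oo, expR (lnY N) = Ynode beta h N (fun i => evG (node N i) g).
  by exists 1%N => // N /= N0; rewrite Ynode_lnY.
apply: cvg_trans (near_eq_cvg e) _; apply: continuous_cvg; first exact: continuous_expR.
have um : measurable_fun setT (u \o f).
  apply: measurableT_comp.
    apply: measurableT_comp; first exact: measurable_ln.
    apply: continuous_measurable_fun; exact: derivable_continuous hC2.2.1.
  by apply: nondecreasing_measurable => //; exact: fG.1.
apply: cvgD; last first.
  apply/cvgrPdist_le => /= e' e'0.
  have [N0 hN] := defect_sum_cvg hG hC2 hinvC2 hK fG e'0.
  by exists N0 => // N /= /hN; rewrite distrC.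
apply/cvgrPdist_le => /= e' e'0.
(* The Riemann sum is off by at most [L / N]: on each cell the deviation is at most [L] times the
   increment of [f], and the increments add up to 1. *)
have d0 : 0 < e' / (beta * L) by rewrite divr_gt0// mulr_gt0.
have [N0 hN] := invr_nat_lt d0; exists N0 => // N /= /hN[N1 Ne].
have cnd i s : node N i <= s <= node N i.+1 ->
    `|ln (chord h (f (node N i)) (f (node N i.+1))) - (u \o f) s| <=
    L * (f (node N i.+1) - f (node N i)).
  by move=> /andP[is1 is2]; apply: Lcu; rewrite !fG.1.
have := riemann_sum um (fun s => Lu (f s)) N1 cnd.
rewrite -mulr_sumr telescope_lift// mulr1 => hr.
rewrite -mulrA -mulrBr normrM (gtr0_norm beta0) distrC.
apply: le_trans (_ : beta * (N%:R^-1 * L) <= _); first by rewrite ler_pM2l.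
rewrite mulrCA -ler_pdivlMr ?mulr_gt0//; exact: ltW.
Qed.

End Pointwise.

(** * Densities and substitution *)

Section Density.
Context d (T : measurableType d) (R : realType).
Variables (mu : {measure set T -> \bar R}) (p : T -> R).
Hypotheses (mp : measurable_fun setT p) (p0 : forall x, 0 <= p x).
Local Open Scope ereal_scope.

(* The two proofs are arguments only so that the measure structure can be inferred. *)
Definition mdens (mp' : measurable_fun setT p) (p0' : forall x, (0 <= p x)%R) (A : set T) :=
  \int[mu]_(x in A) (p x)%:E.

Local Notation nu := (mdens mp p0).

Let mdens0 : nu set0 = 0.
Proof. by rewrite /mdens integral_set0. Qed.

Let mdens_ge0 A : 0 <= nu A.
Proof. by apply: integral_ge0 => x _; rewrite lee_fin. Qed.

Let mdens_sigma_additive : semi_sigma_additive nu.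
Proof.
move=> F mF tF mUF; rewrite /mdens; apply: cvg_toP.
  apply: ereal_nondecreasing_is_cvgn => m n mn.
  apply: lee_sum_nneg_natr => // k _ _.
  by apply: integral_ge0 => /= x Fkx; rewrite lee_fin.
rewrite ge0_integral_bigcup//=.
- by apply: measurable_funTS; apply: measurableT_comp.
- by move=> x _; rewrite lee_fin.
Qed.

HB.instance Definition _ := isMeasure.Build _ _ _ nu mdens0 mdens_ge0 mdens_sigma_additive.

Import HBNNSimple.

Lemma ge0_integral_mdens (f : T -> \bar R) : measurable_fun setT f -> (forall x, 0 <= f x) ->
  \int[nu]_x f x = \int[mu]_x ((p x)%:E * f x).
Proof.
move=> mf f0; pose f_ := nnsfun_approx measurableT mf.
have mpE : measurable_fun setT (EFin \o p) by exact: measurableT_comp.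
transitivity (limn (fun n => \int[nu]_x (f_ n x)%:E)).
  rewrite -monotone_convergence//.
  - apply: eq_integral => y _; apply/esym/cvg_lim => //.
    by apply: cvg_nnsfun_approx.
  - by move=> n; exact/measurable_EFinP/measurable_funP.
  - by move=> n y _; rewrite lee_fin.
  - by move=> y _ m n mn; rewrite lee_fin; exact/lefP/nd_nnsfun_approx.
transitivity (limn (fun n => \int[mu]_x ((p x)%:E * (f_ n x)%:E))); last first.
  rewrite -monotone_convergence//.
  - apply: eq_integral => y _; apply/cvg_lim => //.
    by apply: cvgeZl => //; apply: cvg_nnsfun_approx.
  - by move=> n; apply: emeasurable_funM => //; exact/measurable_EFinP/measurable_funP.
  - by move=> n y _; rewrite mule_ge0// lee_fin.
  - by move=> y _ m n mn; rewrite lee_wpmul2l ?lee_fin//; exact/lefP/nd_nnsfun_approx.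
congr (limn _); apply/funext => n.
transitivity (\sum_(r \in range (f_ n)) r%:E * nu (f_ n @^-1` [set r])).
  under eq_integral do rewrite fimfunE -fsumEFin//.
  rewrite ge0_integral_fsum//; last 2 first.
  - by move=> y; exact/measurable_EFinP/measurable_funM.
  - by move=> y x _; rewrite nnfun_muleindic_ge0.
  apply: eq_fsbigr => r _; rewrite integralZl_indic_nnsfun// integral_indic//=.
  by rewrite setIT.
rewrite [RHS](eq_integral (fun x => \sum_(r \in range (f_ n))
    ((p x)%:E * (r * \1_(f_ n @^-1` [set r]) x)%:E))); last first.
  move=> x _; rewrite {1}fimfunE -fsumEFin// ge0_mule_fsumr// => r.
  exact: nnfun_muleindic_ge0.
rewrite ge0_integral_fsum//; last 2 first.
- by move=> y; apply: emeasurable_funM => //; exact/measurable_EFinP/measurable_funM.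
- by move=> y x _; apply: mule_ge0; [rewrite lee_fin|exact: nnfun_muleindic_ge0].
apply: eq_fsbigr => r _.
rewrite /mdens; have [r0|r0] := leP 0%R r; last first.
  rewrite preimage_nnfun0// integral_set0 mule0 (eq_integral (cst 0)) ?integral0// => x _.
  by rewrite indic0 mulr0 mule0.
rewrite -ge0_integralZl//=; last 2 first.
- by apply: measurable_funTS.
- by move=> x _; rewrite lee_fin.
rewrite integral_mkcond; apply: eq_integral => x _; rewrite patchE indicE.
by case: ifPn => _; rewrite ?mulr1 ?mulr0 ?mule0// muleC.
Qed.

End Density.

Section Substitution.
Context {R : realType}.
Local Notation mu := (@lebesgue_measure R).
Local Open Scope ereal_scope.

(** By the fundamental theorem of calculus the image under [h] of the measure with density [h']
    agrees with Lebesgue measure on intervals, hence everywhere. This yields the substitution for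
    all nonnegative measurable [f]. *)
Lemma ge0_integral_subst (h hinv : R -> R) : (forall x, derivable h x 1) -> continuous (derive1 h) ->
  (forall x, (0 <= derive1 h x)%R) -> cancel h hinv -> cancel hinv h ->
  (forall x y, (h x < h y)%R = (x < y)%R) ->
  forall f : R -> \bar R, measurable_fun setT f -> (forall x, 0 <= f x) ->
  \int[mu]_x f x = \int[mu]_x ((derive1 h x)%:E * f (h x)).
Proof.
move=> hd h1c h10 hK hinvK hlt f mf f0.
have hc : continuous h by move=> x; apply: differentiable_continuous; apply/derivable1_diffP.
have hle x y : (h x <= h y)%R = (x <= y)%R by rewrite !leNgt hlt.
have mh : measurable_fun [set: R] h by exact: continuous_measurable_fun.
have mh1 : measurable_fun [set: R] (derive1 h) by exact: continuous_measurable_fun.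
pose nu := mdens mu mh1 h10.
pose hm : {mfun measurableTypeR R >-> measurableTypeR R} := HB.pack h (isMeasurableFun.Build _ _ (measurableTypeR R) (measurableTypeR R) h mh).
have e A : measurable A -> mu A = pushforward nu hm A.
  apply: lebesgue_measure_unique => _ [[a b]] _ <-.
  rewrite lebesgue_measure_itv/= /pushforward lte_fin.
  have -> : h @^-1` `]a, b] = `]hinv a, hinv b]%classic.
    have E x : (a < h x <= b)%R = (hinv a < x <= hinv b)%R by rewrite -(hlt (hinv a)) -(hle x) !hinvK.
    by apply/seteqP; split => x /=; rewrite !in_itv /= E.
  case: ltP => ab; last first.
    by rewrite set_itv_ge ?measure0// bnd_simp -leNgt -hle !hinvK.
  have hab : (hinv a < hinv b)%R by rewrite -hlt !hinvK.
  rewrite /nu /mdens integral_itv_obnd_cbnd; last by apply: measurable_funTS; exact: measurableT_comp.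
  have dLR : derivable_oo_LRcontinuous h (hinv a) (hinv b).
    split; [by move=> x _; exact: hd|exact: cvg_at_right_filter (hc _)|exact: cvg_at_left_filter (hc _)].
  have c1 : {within `[hinv a, hinv b], continuous (derive1 h)} by exact: continuous_subspaceT.
  by rewrite (continuous_FTC2 hab c1 dLR) ?(hinvK a) ?(hinvK b).
rewrite (@eq_measure_integral _ _ _ _ (pushforward nu hm)); last by move=> A mA _; exact: e.
rewrite ge0_integral_pushforward//.
have mfh : measurable_fun setT (f \o hm) by exact: measurableT_comp.
by rewrite preimage_setT (ge0_integral_mdens _ _ _ mfh (fun x => f0 (h x))).
Qed.

Lemma ge0_integral_shift (f : R -> \bar R) (a : R) : measurable_fun setT f -> (forall x, 0 <= f x) ->
  \int[mu]_x f x = \int[mu]_x f ((x : R) + a)%R.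
Proof.
move=> mf f0.
have d1 (x : R) : is_derive x 1%R (fun y : R => (y + a)%R) 1%R.
  by apply: is_derive_eq; rewrite addr0.
have e x : derive1 (fun y : R => (y + a)%R) x = 1%R by rewrite derive1E; exact: derive_val.
rewrite (@ge0_integral_subst (fun y => (y + a)%R) (fun y => (y - a)%R))//.
- by apply: eq_integral => x _; rewrite e mul1e.
- have -> : derive1 (fun y : R => (y + a)%R) = (fun=> 1%R : R) by exact/funext.
  by move=> x; exact: cvg_cst.
- by move=> x; rewrite e.
- by move=> x; rewrite addrK.
- by move=> x; rewrite subrK.
- by move=> x y; rewrite ltrD2r.
Qed.

(** Cut [[c, c + 1[] at the first integer above [c] and move the right piece back by one period. *)
Lemma ge0_integral_period (f : R -> \bar R) (c : R) : measurable_fun setT f ->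
  (forall x, 0 <= f x) -> (forall x, f (x + 1)%R = f x) ->
  \int[mu]_(x in `[c, (c + 1)%R[) f x = \int[mu]_(x in `[0%R, 1%R[) f x.
Proof.
move=> mf f0 f1.
have shift (a b t : R) : (forall x, f (x + t)%R = f x) ->
    \int[mu]_(x in `[(a + t)%R, (b + t)%R[) f x = \int[mu]_(x in `[a, b[) f x.
  move=> ft; rewrite integral_mkcond (ge0_integral_shift t); last 2 first.
  - by apply/measurable_restrict => //; exact: measurable_funTS.
  - by apply: erestrict_ge0.
  rewrite [RHS]integral_mkcond; apply: eq_integral => x _.
  by rewrite !patchE !mem_setE /= !in_itv /= lerD2r ltrD2r ft.
have fk (k : int) x : f (x + k%:~R)%R = f x.
  have fn (n : nat) : forall y, f (y + n%:R)%R = f y.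
    by elim: n => [|n IHn] y; rewrite ?addr0// -natr1 addrA f1.
  case: k => n; first by rewrite -pmulrn fn.
  by rewrite NegzE mulrNz -pmulrn -[in RHS](subrK n.+1%:R x) fn.
pose k := Num.floor c; pose kr : R := k%:~R.
have /andP[kc ck] : (kr <= c < kr + 1)%R by have := floor_itv c; rewrite intrD.
have split3 (a b z : R) : (a <= b)%R -> (b <= z)%R ->
    \int[mu]_(x in `[a, z[) f x = \int[mu]_(x in `[a, b[) f x + \int[mu]_(x in `[b, z[) f x.
  move=> ab bz; rewrite -ge0_integral_setU//=.
  - by rewrite -itv_bndbnd_setU// bnd_simp.
  - exact: measurable_funTS.
  - apply/disj_setPS => x [] /=; rewrite !in_itv /= => /andP[_ xb] /andP[bx _].
    by move: (lt_le_trans xb bx); rewrite ltxx.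
have -> : \int[mu]_(x in `[0%R, 1%R[) f x = \int[mu]_(x in `[kr, (kr + 1)%R[) f x.
  by rewrite -(shift 0%R 1%R kr (fk k)) add0r addrC.
rewrite (split3 c (kr + 1)%R (c + 1)%R) ?lerD2r//; last exact: ltW.
rewrite (shift kr c 1%R f1) addeC -split3//; exact: ltW.
Qed.

(** [h] carries [[0, 1[] onto [[h 0, h 0 + 1[], in general another fundamental domain; composing [f]
    with [frac] makes the choice of domain irrelevant. *)
Lemma integral_circle_subst (h hinv : R -> R) : isGlift h -> isC2 h -> isC2 hinv ->
  cancel h hinv -> cancel hinv h ->
  forall f : R -> \bar R, measurable_fun setT f -> (forall x, 0 <= f x) ->
  \int[mu]_(x in `[0%R, 1%R[) f x =
  \int[mu]_(x in `[0%R, 1%R[) ((derive1 h x)%:E * f (frac (h x))).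
Proof.
move=> hG hC2 hinvC2 hK hinvK f mf f0.
have h10 x : (0 <= derive1 h x)%R by apply/ltW/(derive1_diffeo_gt0 hG hC2 hinvC2 hK).
have mff : measurable_fun setT (f \o @frac R) by apply: measurableT_comp => //; exact: measurable_frac.
have mh1 : measurable_fun setT (derive1 h).
  by apply: continuous_measurable_fun; exact: derivable_continuous hC2.2.1.
have -> : \int[mu]_(x in `[0%R, 1%R[) f x = \int[mu]_(x in `[0%R, 1%R[) (f \o @frac R) x.
  by apply: eq_integral => x; rewrite inE /= in_itv /= => x01; rewrite frac_id.
have per x : (f \o @frac R) (x + 1)%R = (f \o @frac R) x.
  by rewrite /= -[X in (x + X)%R]/(1%:~R) fracDz.
rewrite -(@ge0_integral_period _ (h 0%R) mff (fun x => f0 _) per).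
rewrite integral_mkcond (@ge0_integral_subst h hinv)//; last 5 first.
- exact: hC2.1.
- exact: derivable_continuous hC2.2.1.
- exact: diffeo_lt hG hK.
- by apply/measurable_restrict => //; exact: measurable_funTS.
- by apply: erestrict_ge0 => x _; exact: f0.
rewrite [RHS]integral_mkcond; apply: eq_integral => x _.
rewrite !patchE !mem_setE /= !in_itv /= -hG.2.2 add0r (diffeo_le hG hK) (diffeo_lt hG hK).
by case: ifP; rewrite ?mule0.
Qed.

End Substitution.

(** * Iterated integrals *)

Section Vectors.
Context {R : realType}.
Local Notation mu := (@lebesgue_measure R).

Definition coord_sets (N : nat) : set (set (nat -> R)) :=
  [set A | exists i (B : set R), [/\ (i < N)%N, measurable B & A = (fun x => x i) @^-1` B]].

(** Whole sequences, to match the integrands of [iint], but with the sigma-algebra that sees only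
    the first [N] coordinates. *)
Definition vec N := g_sigma_algebraType (coord_sets N).

HB.instance Definition _ N := Measurable.on (vec N).

Lemma measurable_coord N i : (i < N)%N -> measurable_fun [set: vec N] (fun x : vec N => x i : R).
Proof. by move=> iN _ B mB; rewrite setTI; apply: sub_sigma_algebra; exists i, B. Qed.

Lemma measurable_vec d (T : measurableType d) N (F : T -> vec N) :
  (forall i, (i < N)%N -> measurable_fun setT (fun t => F t i : R)) -> measurable_fun setT F.
Proof.
move=> mF; apply: (@measurability _ _ T (vec N) setT F (coord_sets N)); first by [].
by move=> _ [_ [i [B [iN mB ->]]] <-]; exact: mF.
Qed.

Definition upd (n : nat) (y : R) (x : nat -> R) : nat -> R := fun i => if i == n then y else x i.

Lemma measurable_upd n N :
  measurable_fun [set: measurableTypeR R * vec N] (fun z => upd n z.1 z.2 : vec N).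
Proof.
apply: measurable_vec => i iN; rewrite /upd; case: eqP => _.
  exact: measurable_fst.
by apply: measurableT_comp (measurable_coord iN) _; exact: measurable_snd.
Qed.

Lemma measurable_upd_coord n N (y : R) :
  measurable_fun [set: vec N] (fun x => upd n y x : vec N).
Proof.
apply: measurable_vec => i iN; rewrite /upd; case: eqP => _; first exact: measurable_cst.
exact: measurable_coord.
Qed.

Lemma iint_eq n (F G : (nat -> R) -> \bar R) :
  (forall x, (forall i, (i < n)%N -> 0 <= x i < 1) -> (forall i, (n <= i)%N -> x i = 0) -> F x = G x) ->
  iint n F = iint n G.
Proof.
elim: n F G => [|n IHn] F G FG /=; first exact: FG.
apply: eq_integral => y; rewrite inE /= in_itv /= => y01; apply: IHn => x x01 x0.
apply: FG => i.
  by rewrite ltnS leq_eqVlt; case: eqP => [//|_] /=; exact: x01.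
by move=> ni; rewrite gtn_eqF// x0// ltnW.
Qed.

Local Open Scope ereal_scope.

Lemma integral_unit_prob (f : R -> \bar R) : measurable_fun setT f -> (forall x, 0 <= f x) ->
  \int[uniform_prob (@ltr01 R)]_x f x = \int[mu]_(x in `[0%R, 1%R[) f x.
Proof.
move=> mf f0; rewrite integral_uniform// subr0 invr1 mul1e integral_itv_bndo_bndc//.
exact: measurable_funTS.
Qed.

(** Reading the iterated integral as one integral against a probability makes Tonelli, linearity and
    densities available. The probability is built from the point mass at the zero sequence by
    filling in one uniform coordinate at a time. *)
Lemma iint_prob N n : (n <= N)%N -> exists P : probability (vec N) R,
  forall F : vec N -> \bar R, measurable_fun setT F -> (forall x, 0 <= F x) ->
  iint n F = \int[P]_x F x.
Proof.
elim: n => [_|n IHn nN].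
  exists (\d_((fun=> 0%R) : vec N)) => F mF F0.
  by rewrite integral_dirac// diracT mul1e.
have [P hP] := IHn (ltnW nN).
pose X : {mfun (measurableTypeR R * vec N)%type >-> vec N} :=
  HB.pack (fun z : measurableTypeR R * vec N => upd n z.1 z.2 : vec N)
    (isMeasurableFun.Build _ _ _ _ _ (@measurable_upd n N)).
exists (distribution (uniform_prob (@ltr01 R) \x P) X) => F mF F0.
have mX : measurable_fun setT (F \o X) := measurableT_comp mF (@measurable_upd n N).
have X0 x : 0 <= (F \o X) x by exact: F0.
rewrite ge0_integral_pushforward// preimage_setT fubini_tonelli1//.
rewrite integral_unit_prob//.
- rewrite -[LHS]/(\int[mu]_(y in `[0%R, 1%R[) iint n (F \o upd n y)).
  apply: eq_integral => y _; rewrite /fubini_F (hP (F \o upd n y))//; last by move=> x; exact: F0.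
  exact: (measurableT_comp mF (measurable_upd_coord n y)).
- exact: measurable_fun_fubini_tonelli_F.
- by move=> y; apply: integral_ge0.
Qed.

Lemma iint_ge0 n (F : (nat -> R) -> \bar R) : (forall x, 0 <= F x) -> 0 <= iint n F.
Proof.
elim: n F => [|n IHn] F F0 /=; first exact: F0.
by apply: integral_ge0 => y _; apply: IHn => x; exact: F0.
Qed.

Lemma measurable_iint N n d (T : measurableType d) (F : T * vec N -> \bar R) : (n <= N)%N ->
  measurable_fun setT F -> (forall z, 0 <= F z) ->
  measurable_fun setT (fun t => iint n (fun x => F (t, x))).
Proof.
move=> nN mF F0; have [P hP] := iint_prob nN.
rewrite (_ : (fun t => _) = fubini_F P F); last first.
  apply/funext => t; rewrite /fubini_F hP//.
  apply: (measurableT_comp mF).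
  by apply/measurable_fun_pair; [exact: measurable_cst|exact: measurable_id].
exact: measurable_fun_fubini_tonelli_F.
Qed.

Lemma iintZl N n (k : R) (F : vec N -> \bar R) : (n <= N)%N -> (0 <= k)%R ->
  measurable_fun setT F -> (forall z, 0 <= F z) ->
  iint n (fun x => k%:E * F x) = k%:E * iint n F.
Proof.
move=> nN k0 mF F0; have [P hP] := iint_prob nN.
rewrite !hP// ?ge0_integralZl//.
  by apply: emeasurable_funM => //; exact: measurable_cst.
by move=> x; rewrite mule_ge0// lee_fin.
Qed.

Definition shift_map (h : R -> R) (n : nat) (x : nat -> R) : nat -> R :=
  fun i => if (i < n)%N then frac (h (x i)) else x i.

Lemma measurable_shift_map (h : R -> R) n N : measurable_fun setT h ->
  measurable_fun [set: vec N] (fun x => shift_map h n x : vec N).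
Proof.
move=> mh; apply: measurable_vec => i iN; rewrite /shift_map; case: (i < n)%N.
  apply: measurableT_comp; first exact: measurable_frac.
  by apply: measurableT_comp => //; exact: measurable_coord.
exact: measurable_coord.
Qed.

(** [h] acts on each coordinate separately, so one circle substitution per coordinate suffices; the
    outer factor is moved inside the remaining integrals by [iintZl]. *)
Lemma iint_subst (h hinv : R -> R) : isGlift h -> isC2 h -> isC2 hinv ->
  cancel h hinv -> cancel hinv h ->
  forall N n (F : vec N -> \bar R), (n <= N)%N -> measurable_fun setT F -> (forall x, 0 <= F x) ->
  iint n F = iint n (fun x => (\prod_(i < n) derive1 h (x i))%:E * F (shift_map h n x)).
Proof.
move=> hG hC2 hinvC2 hK hinvK N n.
have h10 x : (0 <= derive1 h x)%R by apply/ltW/(derive1_diffeo_gt0 hG hC2 hinvC2 hK).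
have mh1 : measurable_fun setT (derive1 h).
  by apply: continuous_measurable_fun; exact: derivable_continuous hC2.2.1.
have mh : measurable_fun setT h.
  by apply: continuous_measurable_fun; exact: derivable_continuous hC2.1.
elim: n => [|n IHn] F nN mF F0 /=.
  by rewrite big_ord0 mul1e; congr F.
have nN' := ltnW nN.
have mFu : measurable_fun [set: measurableTypeR R * vec N] (F \o (fun z => upd n z.1 z.2)).
  by apply: measurableT_comp => //; exact: measurable_upd.
rewrite -/(upd n) (integral_circle_subst hG hC2 hinvC2 hK hinvK)//; last 2 first.
- exact: (measurable_iint nN' mFu (fun z => F0 _)).
- by move=> x; apply: iint_ge0.
apply: eq_integral => y _; rewrite (IHn (F \o upd n (frac (h y))))//; last 2 first.
- exact: (measurableT_comp mF (measurable_upd_coord n (frac (h y)))).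
- by move=> x; exact: F0.
rewrite -(@iintZl N)//; last 2 first.
- apply: emeasurable_funM.
    apply/measurable_EFinP; apply: measurable_prod => i _.
    apply: measurableT_comp => //; apply: measurable_coord; exact: leq_trans (ltn_ord i) nN'.
  exact: (measurableT_comp (measurableT_comp mF (measurable_upd_coord n (frac (h y))))
    (measurable_shift_map n mh)).
- move=> x; apply: mule_ge0; last exact: F0.
  by rewrite lee_fin prodr_ge0.
apply: iint_eq => x _ _; rewrite muleA; congr (_ * F _).
  rewrite big_ord_recr /= eqxx -EFinM mulrC; congr (_ * _)%:E.
  by apply: eq_bigr => i _; rewrite ltn_eqF.
apply/funext => i; rewrite /upd /shift_map.
by case: (ltngtP i n) => [ilt|igt|->]; rewrite ?ltnS ?leqnn// ?(ltnW ilt)// leqNgt igt.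
Qed.

End Vectors.

(** * Law of the values at the nodes *)

Section Law.
Context {R : realType}.
Local Open Scope ereal_scope.

Lemma measure_unique_pi d (T : measurableType d) (m1 m2 : {measure set T -> \bar R})
    (G : set (set T)) : @measurable _ T = <<s G >> -> setI_closed G ->
  m1 setT = m2 setT -> m1 setT < +oo -> (forall A, G A -> m1 A = m2 A) ->
  forall A, measurable A -> m1 A = m2 A.
Proof.
move=> mG GI e fin eG A.
have H : [set X | G X /\ X `<=` setT] = G by apply/seteqP; split => X //= [].
rewrite mG -H; apply: g_sigma_algebra_measure_unique_trace => //.
- by rewrite H mG; exact: sub_sigma_algebra.
- by rewrite H.
- by rewrite H.
Qed.

Lemma measurable_evG t : measurable_fun [set: Gmeas R] (fun g => evG t g).
Proof. by move=> _ B mB; rewrite setTI; apply: sub_sigma_algebra; exists t, B. Qed.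

(** Zero from [N] on, like the sequences on which [iint N] evaluates its integrand. *)
Definition node_values N (g : Gty R) : nat -> R :=
  fun i => if (i < N)%N then evG (node N i) g else 0%R.

Lemma measurable_node_values N : measurable_fun [set: Gmeas R] (fun g => node_values N g : vec N).
Proof.
apply: measurable_vec => i iN; rewrite /node_values iN; exact: measurable_evG.
Qed.

Lemma nxt_lt N i : (i < N)%N -> (nxt N i < N)%N.
Proof. by rewrite /nxt => iN; case: eqP => [_|/eqP ne]; [exact: leq_ltn_trans iN|rewrite ltn_neqAle ne]. Qed.

Lemma measurable_arc N i : (i < N)%N ->
  measurable_fun [set: @vec R N] (fun x : @vec R N => arc (x i) (x (nxt N i))).
Proof.
move=> iN; apply: measurableT_comp; first exact: measurable_frac.
by apply: measurable_funB; apply: measurable_coord => //; exact: nxt_lt.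
Qed.

Lemma measurable_arc_sum N :
  measurable_fun [set: @vec R N] (fun x : @vec R N => \sum_(i < N) arc (x i) (x (nxt N i)))%R.
Proof. by apply: measurable_sum => i; apply: measurable_arc. Qed.

Lemma Gamma_ge0 (s : R) : (0 <= Gamma s)%R.
Proof.
apply: fine_ge0; apply: integral_ge0 => x _.
by rewrite lee_fin mulr_ge0 ?powR_ge0 ?expR_ge0.
Qed.

Lemma dirdens_ge0 beta N t x : (0 <= dirdens beta N t x :> R)%R.
Proof.
rewrite /dirdens; case: ifP => // _; rewrite mulr_ge0//.
  by rewrite divr_ge0 ?Gamma_ge0// prodr_ge0// => i _; exact: Gamma_ge0.
by rewrite prodr_ge0// => i _; exact: powR_ge0.
Qed.

Lemma measurable_dirdens (beta : R) N t :
  measurable_fun [set: vec N] (fun x : vec N => dirdens beta N t x).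
Proof.
apply: measurable_fun_ifT.
- apply: measurable_fun_eqr; [exact: measurable_arc_sum|exact: measurable_cst].
- apply: measurable_funM; first exact: measurable_cst.
  apply: measurable_prod => i _.
  exact: (measurableT_comp (measurable_powR _) (measurable_arc (ltn_ord i))).
- exact: measurable_cst.
Qed.

(** The selector [p] leaves coordinates unconstrained, so that the whole space is a box and
    intersections of boxes are boxes. *)
Definition lower_boxes N : set (set (nat -> R)) :=
  [set A | exists (p : nat -> bool) (b : nat -> R),
    A = [set x | forall i, (i < N)%N -> p i -> (x i < b i)%R]].

Lemma setI_closed_lower_boxes N : setI_closed (lower_boxes N).
Proof.
move=> _ _ [p [b ->]] [q [c ->]].
exists (fun i => p i || q i),
  (fun i => if p i then if q i then Num.min (b i) (c i) else b i else c i).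
apply/seteqP; split => x.
- move=> [hb hc] i iN; have := hb i iN; have := hc i iN.
  by case: (p i); case: (q i) => //= h1 h2; rewrite ?lt_min ?h1 ?h2.
- move=> /= hx; split => i iN; have := hx i iN.
  + by case: (p i); case: (q i) => //= /(_ isT); rewrite ?lt_min => /andP[].
  + by case: (p i); case: (q i) => //= /(_ isT); rewrite ?lt_min => /andP[].
Qed.

Lemma vec_lower_boxes N : @measurable _ (vec N) = <<s lower_boxes N >>.
Proof.
apply/seteqP; split.
- apply: smallest_sub; first exact: smallest_sigma_algebra.
  move=> _ [i [B [iN mB ->]]].
  have mi : measurable_fun [set: g_sigma_algebraType (lower_boxes N)] (fun x => x i : R).
    apply: (measurability _ (RGenInftyO.measurableE R)) => //.
    move=> _ [_ [a ->] <-]; rewrite setTI; apply: sub_sigma_algebra.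
    exists (fun j => j == i), (fun=> a); apply/seteqP; split => x /=.
      by rewrite in_itv /= => xa j _ /eqP ->.
    by rewrite in_itv /= => /(_ i iN (eqxx _)).
  by have := mi measurableT B mB; rewrite setTI.
- apply: smallest_sub; first exact: sigma_algebra_measurable.
  move=> _ [p [b ->]].
  have -> : [set x : nat -> R | forall i, (i < N)%N -> p i -> (x i < b i)%R] =
      \bigcap_i (if (i < N)%N && p i then [set x : vec N | (x i < b i)%R] else setT).
    apply/seteqP; split => x /= hx i.
      by move=> _; case: ifP => // /andP[iN pi]; exact: hx.
    by move=> iN pi; have := hx i I; rewrite iN pi.
  apply: bigcapT_measurable => i; case: ifP => [/andP[iN _]|_]; last exact: measurableT.
  rewrite (_ : mkset _ = setT `&` (fun x : vec N => x i : R) @^-1` `]-oo, b i[%classic).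
    exact: measurable_coord.
  by rewrite setTI; apply/seteqP; split => x /=; rewrite in_itv.
Qed.

Variables (beta : R) (Q : probability (Gmeas R) R).
Hypothesis hQ : isQbeta beta Q.

Lemma node_arc N i : (1 < N)%N -> (i < N)%N ->
  (arc (node N i) (node N (nxt N i)) = N%:R^-1 :> R)%R.
Proof.
move=> N1 iN; have Np : (0 < N%:R :> R)%R by rewrite ltr0n (ltn_trans _ N1).
have inv01 : (0 <= (N%:R^-1 : R) < 1)%R by rewrite invr_ge0 ltW//= invf_lt1// ltr1n.
rewrite /arc /nxt; case: eqP => [e|_].
  apply: (@frac_eq _ _ _ (-1)) => //.
  have n0 : (node N 0 = 0 :> R)%R by rewrite /node mul0r.
  have n1 : (node N N = 1 :> R)%R by rewrite /node divff// gt_eqF.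
  have := nodeS (R := R) N i; rewrite e n1 n0 mulrN1z; lra.
by rewrite nodeS (addrC (node N i)) addrK frac_id.
Qed.

Lemma iint_box N (p : nat -> bool) (b : nat -> R) : (1 < N)%N ->
  Q [set g : Gmeas R | forall i, (i < N)%N -> p i -> (evG (node N i) g < b i)%R] =
  iint N (fun x => (dirdens beta N (node N) x)%:E *
    (\1_[set x : nat -> R | forall i, (i < N)%N -> p i -> (x i < b i)%R] x)%:E).
Proof.
(* Clamping to [[0, 1]] gives a box of the kind tested by [isQbeta] with the same trace on [[0, 1[];
   an unconstrained coordinate gets the bound 1. *)
move=> N1; pose b' i : R := (if p i then Num.max 0 (Num.min (b i) 1) else 1)%R.
have Np : (0 < N%:R :> R)%R by rewrite ltr0n (ltn_trans _ N1).
have b'E i (y : R) : (0 <= y < 1)%R -> (0 <= y < b' i)%R = (p i ==> (y < b i)%R).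
  move=> /andP[y0 y1]; rewrite y0 /= /b'; case: (p i) => //=.
  by rewrite lt_max lt_min y1 andbT ltNge y0.
have -> : [set g : Gmeas R | forall i, (i < N)%N -> p i -> (evG (node N i) g < b i)%R] =
    [set g : Gmeas R | forall i, (i < N)%N -> (0 <= evG (node N i) g < b' i)%R].
  apply/seteqP; split => g /= hg i iN.
    by rewrite b'E ?frac_itv//; apply/implyP; exact: hg.
  by move=> pi; have := hg i iN; rewrite b'E ?frac_itv// pi.
have c1 i : (i < N)%N -> (0 < arc (node N i : R) (node N (nxt N i)))%R.
  by move=> iN; rewrite node_arc// invr_gt0.
have c2 : (\sum_(i < N) arc (node N i : R) (node N (nxt N i)) = 1)%R.
  rewrite (eq_bigr (fun=> N%:R^-1 : R)%R); last by move=> i _; rewrite node_arc.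
  by rewrite sumr_const card_ord -[(_ *+ _)%R]mulr_natl divff// gt_eqF.
have c3 i : (i < N)%N -> (0 <= (0 : R) <= b' i)%R /\ (b' i <= 1)%R.
  move=> _; rewrite /b'; case: (p i); last by rewrite !lexx ler01.
  by rewrite lexx le_max lexx /= ge_max ler01 ge_min lexx orbT.
rewrite (hQ N1 c1 c2 c3).
apply: iint_eq => x x01 _; rewrite -EFinM mulrC; congr (_ * _)%:E.
rewrite indicE; case: (boolP (x \in _)) => [/set_mem /= xb|/negP xb].
  rewrite big1// => i _; rewrite b'E ?x01// (introT implyP)//; exact: xb.
apply/eqP; rewrite prodf_seq_eq0; apply/hasP; apply: contrapT => nh.
apply: xb; apply/mem_set => i iN pi; rewrite ltNge; apply/negP => bx.
apply: nh; exists (Ordinal iN); first by rewrite mem_index_enum.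
by rewrite /= b'E ?x01// pi /= ltNge bx.
Qed.

Lemma node_law N (F : vec N -> \bar R) : (1 < N)%N -> measurable_fun setT F -> (forall x, 0 <= F x) ->
  \int[Q]_g F (node_values N g) = iint N (fun x => (dirdens beta N (node N) x)%:E * F x).
Proof.
move=> N1 mF F0; have [P hP] := @iint_prob R _ _ (leqnn N).
have md : measurable_fun [set: vec N] (fun x : vec N => dirdens beta N (node N) x).
  exact: measurable_dirdens.
pose m2 := mdens P md (fun x => dirdens_ge0 beta N (node N) x).
pose X : {mfun Gmeas R >-> vec N} :=
  HB.pack (fun g : Gmeas R => node_values N g : vec N)
    (isMeasurableFun.Build _ _ _ _ _ (@measurable_node_values N)).
have mdE : measurable_fun [set: vec N] (fun x : vec N => (dirdens beta N (node N) x)%:E).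
  exact/measurable_EFinP.
have boxE A : lower_boxes N A -> distribution Q X A = m2 A.
  move=> bA; have mA : measurable (A : set (vec N)).
    by rewrite vec_lower_boxes; exact: sub_sigma_algebra.
  case: bA mA => p [b ->] mA.
  have -> : distribution Q X [set x | forall i, (i < N)%N -> p i -> (x i < b i)%R] =
      Q [set g : Gmeas R | forall i, (i < N)%N -> p i -> (evG (node N i) g < b i)%R].
    congr (Q _); apply/seteqP; split => g /= hg i iN pi.
      by have := hg i iN pi; rewrite /node_values iN.
    by rewrite /node_values iN; exact: hg.
  rewrite iint_box// hP.
  - rewrite /m2 /mdens integral_mkcond; apply: eq_integral => x _.
    by rewrite patchE indicE; case: ifPn => _; rewrite ?mule1 ?mule0.
  - by apply: emeasurable_funM => //; apply/measurable_EFinP; exact: measurable_indic.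
  - by move=> x; rewrite mule_ge0// lee_fin ?dirdens_ge0.
have allE : distribution Q X setT = m2 setT.
  apply: boxE; exists (fun=> false), (fun=> 0%R).
  by apply/seteqP; split.
have fin : distribution Q X setT < +oo by rewrite probability_setT ltry.
have e := measure_unique_pi (vec_lower_boxes N) (@setI_closed_lower_boxes N) allE fin boxE.
have mFX : measurable_fun setT (F \o X) by exact: measurableT_comp.
transitivity (\int[distribution Q X]_x F x).
  by rewrite ge0_integral_pushforward// preimage_setT.
rewrite (@eq_measure_integral _ _ _ _ m2); last by move=> A mA _; exact: e.
rewrite ge0_integral_mdens// hP//.
- exact: emeasurable_funM.
- by move=> x; rewrite mule_ge0// lee_fin dirdens_ge0.
Qed.

End Law.

(** * Quasi-invariance *)

(* At least two nodes, as [isQbeta] requires. *)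
Definition nodes n := (2 ^ n.+1)%N.

Lemma nodes_gt1 n : (1 < nodes n)%N.
Proof. by rewrite /nodes expnS; have := expn_gt0 2 n; lia. Qed.

Lemma nodes_cvg : nodes n @[n --> \oo] --> \oo.
Proof.
move=> A [N _ hA]; exists N => // n /= Nn; apply: hA => /=.
have h1 : (n < 2 ^ n)%N by apply: ltn_expl.
have h2 : (2 ^ n <= 2 ^ n.+1)%N by rewrite leq_exp2l.
exact: leq_trans Nn (leq_trans (ltnW h1) h2).
Qed.

Section CircleMaps.
Context {R : realType}.

Lemma isG_comp (k : R -> R) (g : Gty R) : isGlift k -> continuous k ->
  isG (normlift (k \o sval g)).
Proof.
move=> kG kc; have gG := Gty_lift g; split; last exact: frac_itv.
split; [|split].
- by move=> x y xy; rewrite lerD2r; apply: kG.1; exact: gG.1.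
- move=> x; apply: cvgB; last exact: cvg_cst.
  by apply: continuous_cvg; [exact: kc|exact: gG.2.1].
- by move=> x; rewrite /normlift /= gG.2.2 kG.2.2 addrAC.
Qed.

Lemma sval_tau (k : R -> R) (g : Gty R) : isGlift k -> continuous k ->
  sval (tau k g) = normlift (k \o sval g).
Proof. by move=> kG kc; apply: insubdK; apply/asboolP; exact: isG_comp. Qed.

Lemma evG_tau (k : R -> R) (g : Gty R) t : isGlift k -> continuous k ->
  evG t (tau k g) = frac (k (evG t g)).
Proof.
by move=> kG kc; rewrite /evG sval_tau// /normlift /= fracBz frac_isGlift.
Qed.

Lemma tauK (k l : R -> R) : isGlift k -> isGlift l -> continuous k -> continuous l ->
  cancel k l -> cancel (@tau R k) (tau l).
Proof.
move=> kG lG kc lc kK g; apply: val_inj; rewrite /= sval_tau// sval_tau//.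
have /asboolP[_ g0] := svalP g.
apply/funext => x; rewrite /normlift /= -!mulrNz !(isGliftDz lG) !kK.
(* The first normalization shifts by the integer [n]; the second one removes exactly [n] because
   [g 0] lies in [[0, 1[]. *)
set n : int := (- Num.floor _)%R.
rewrite (@floor_def _ _ n).
  by rewrite mulrNz addrK.
by move: g0; rewrite intrD; lra.
Qed.

Lemma measurable_tau (k : R -> R) : isGlift k -> continuous k ->
  measurable_fun [set: Gmeas R] (tau k : Gmeas R -> Gmeas R).
Proof.
move=> kG kc; apply: (@measurability _ _ (Gmeas R) (Gmeas R) setT _ (evsets (R:=R))); first by [].
move=> _ [_ [t [B [mB ->]]] <-].
rewrite (_ : tau k @^-1` (evG t @^-1` B) = (fun g => frac (k (evG t g))) @^-1` B); last first.
  by apply/seteqP; split => g /=; rewrite evG_tau.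
have : measurable_fun [set: Gmeas R] (fun g => frac (k (evG t g))).
  apply: measurableT_comp; first exact: measurable_frac.
  apply: measurableT_comp; last exact: measurable_evG.
  exact: continuous_measurable_fun.
by apply.
Qed.

Lemma cyclic_sum N (F : nat -> R) : (0 < N)%N -> \sum_(i < N) F (nxt N i) = \sum_(i < N) F i.
Proof.
case: N => // N _; rewrite big_ord_recr big_ord_recl /= addrC; congr (_ + _).
  by rewrite /nxt eqxx.
by apply: eq_bigr => i _; rewrite /nxt /= eqSS ltn_eqF.
Qed.

End CircleMaps.

(** * Change of density under the diffeomorphism and passage to the limit *)

Section Transform.
Context {R : realType} (beta : R) (h hinv : R -> R).
Hypothesis beta0 : 0 < beta.
Hypothesis hG : isGlift h.
Hypothesis hC2 : isC2 h.
Hypothesis hinvC2 : isC2 hinv.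
Hypothesis hK : cancel h hinv.
Hypothesis hinvK : cancel hinv h.

Let hc : continuous h := derivable_continuous hC2.1.
Let hinvc : continuous hinv := derivable_continuous hinvC2.1.
Let hinvG : isGlift hinv := isGlift_inv hG hinvC2 hK hinvK.
Let h1_gt0 x : 0 < derive1 h x := derive1_diffeo_gt0 hG hC2 hinvC2 hK x.

Lemma arcE (a b : R) : a + arc a b = b + (- Num.floor (b - a))%:~R.
Proof. by rewrite /arc /frac mulrNz; ring. Qed.

(** Over an arc shorter than 1 the increment of [h] is below 1, hence equal to its own fractional
    part. *)
Lemma arc_shiftE (a b : R) : arc (frac (h a)) (frac (h b)) = h (a + arc a b) - h a.
Proof.
rewrite arc_frac; apply: (@frac_eq _ _ _ (Num.floor (b - a))); last first.
  by rewrite arcE (isGliftDz hG) mulrNz; ring.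
have /andP[a0 a1] : 0 <= arc a b < 1 by exact: frac_itv.
have : h a <= h (a + arc a b) by apply: hG.1; lra.
have : h (a + arc a b) < h (a + 1) by rewrite (diffeo_lt hG hK); lra.
by rewrite hG.2.2; lra.
Qed.

(** Both arcs drop the same integer, so the difference is a cyclic sum of increments of [h z - z].
    Hence [h] preserves the constraint in [dirdens] that the points are in cyclic order. *)
Lemma arc_sum_shift N (x : nat -> R) : (0 < N)%N ->
  \sum_(i < N) arc (frac (h (x i))) (frac (h (x (nxt N i)))) = \sum_(i < N) arc (x i) (x (nxt N i)).
Proof.
move=> N0; have s F : \sum_(i < N) (F (nxt N i) - F i) = 0 :> R.
  by rewrite sumrB cyclic_sum// subrr.
apply/eqP; rewrite -subr_eq0 -sumrB -[X in _ == X](s (fun i => h (x i) - x i)).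
apply/eqP/eq_bigr => i _; rewrite arc_shiftE arcE (isGliftDz hG) /arc /frac mulrNz.
ring.
Qed.

(** Each arc is multiplied by its chord, which enters with the Dirichlet exponent [beta / N - 1].
    When the arcs do not sum to 1 both sides vanish, so the exceptional branch of [Ynode] is never
    compared. *)
Lemma dirdens_shift N (x : nat -> R) : (1 < N)%N ->
  (\prod_(i < N) derive1 h (x i)) * dirdens beta N (node N) (shift_map h N x) =
  Ynode beta h N x * dirdens beta N (node N) x.
Proof.
move=> N1; rewrite /dirdens /Ynode.
have E i : (i < N)%N -> arc (shift_map h N x i) (shift_map h N x (nxt N i)) =
    arc (frac (h (x i))) (frac (h (x (nxt N i)))).
  by move=> iN; rewrite /shift_map iN nxt_lt.
have -> : \sum_(i < N) arc (shift_map h N x i) (shift_map h N x (nxt N i)) =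
    \sum_(i < N) arc (x i) (x (nxt N i)).
  rewrite -[RHS]arc_sum_shift ?(ltn_trans _ N1)//; apply: eq_bigr => i _.
  by rewrite E.
case: eqP => [->|_]; last by rewrite !mulr0.
rewrite oner_eq0 [LHS]mulrCA [RHS]mulrCA; congr (_ * _).
rewrite -!big_split; apply: eq_bigr => i _ /=.
rewrite E// arc_shiftE -chord_mul addrAC subrr add0r node_arc//.
have a0 : 0 <= arc (x i) (x (nxt N i)) by exact: arc_ge0.
rewrite powRM//; last by apply/ltW/(chord_gt0 hG hC2 hinvC2 hK); rewrite lerDl.
by rewrite -[beta / _]/(beta * _); ring.
Qed.

Lemma Ynode_ge0 N x : 0 <= Ynode beta h N x.
Proof.
rewrite /Ynode; case: ifP => _; first exact: powR_ge0.
by apply: prodr_ge0 => i _; rewrite mulr_ge0 ?powR_ge0// ltW.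
Qed.

Lemma eq_Ynode N (x y : nat -> R) : (0 < N)%N -> (forall i, (i < N)%N -> x i = y i) ->
  Ynode beta h N x = Ynode beta h N y.
Proof.
move=> N0 xy; rewrite /Ynode xy//.
have E (i : 'I_N) : arc (x i) (x (nxt N i)) = arc (y i) (y (nxt N i)).
  by rewrite !xy// nxt_lt.
rewrite (eq_bigr _ (fun i _ => E i)); case: ifP => // _.
by apply: eq_bigr => i _; rewrite E xy.
Qed.

Lemma Ynode_values N (g : Gty R) : (0 < N)%N ->
  Ynode beta h N (node_values N g) = Ynode beta h N (fun i => evG (node N i) g).
Proof. by move=> N0; apply: eq_Ynode => // i iN; rewrite /node_values iN. Qed.

Lemma measurable_Ynode N : (0 < N)%N ->
  measurable_fun [set: @vec R N] (fun x : @vec R N => Ynode beta h N x).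
Proof.
move=> N0.
have mh1 : measurable_fun setT (derive1 h).
  by apply: continuous_measurable_fun; exact: derivable_continuous hC2.2.1.
have mh : measurable_fun setT h by exact: continuous_measurable_fun.
have mh1i i : (i < N)%N -> measurable_fun [set: @vec R N] (fun x : @vec R N => derive1 h (x i)).
  by move=> iN; exact: (measurableT_comp mh1 (measurable_coord iN)).
apply: measurable_fun_ifT.
- by apply: measurable_fun_eqr; [exact: measurable_arc_sum|exact: measurable_cst].
- exact: (measurableT_comp (measurable_powR _) (mh1i _ N0)).
apply: measurable_prod => i _; apply: measurable_funM; last exact: mh1i.
apply: (measurableT_comp (measurable_powR _)).
have ma := measurable_arc (R := R) (ltn_ord i).
rewrite (_ : (fun x : vec N => _) = (fun x : vec N =>
  if arc (x i) (x (nxt N i)) == 0 then derive1 h (x i)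
  else (h (x i + arc (x i) (x (nxt N i))) - h (x i)) * arc (x i) (x (nxt N i)) `^ (-1))).
  apply: measurable_fun_ifT; [|exact: mh1i|].
    by apply: measurable_fun_eqr; [exact: ma|exact: measurable_cst].
  apply: measurable_funM; last exact: (measurableT_comp (measurable_powR _) ma).
  apply: measurable_funB; last exact: (measurableT_comp mh (measurable_coord (ltn_ord i))).
  apply: (measurableT_comp mh); apply: measurable_funD => //.
  exact: measurable_coord.
apply/funext => x; rewrite /chord -subr_eq0 opprD addrA subrr add0r oppr_eq0.
case: ifP => // _; rewrite powR_inv1 ?arc_ge0//.
by congr (_ / _); rewrite addrAC subrr add0r.
Qed.

Variable Q : probability (Gmeas R) R.
Hypothesis hQ : isQbeta beta Q.

Lemma node_values_tau N (g : Gty R) :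
  node_values N (tau hinv g) = shift_map hinv N (node_values N g).
Proof.
apply/funext => i; rewrite /node_values /shift_map; case: ifP => // iN.
by rewrite evG_tau.
Qed.

Lemma node_transform N (B : set (@vec R N)) : (1 < N)%N -> measurable B ->
  (Q (tau hinv @^-1` ((fun g : Gmeas R => node_values N g : vec N) @^-1` B)) =
  \int[Q]_(g in (fun g : Gmeas R => node_values N g : vec N) @^-1` B)
    (Ynode beta h N (node_values N g))%:E)%E.
Proof.
move=> N1 mB; have N0 : (0 < N)%N by apply: ltn_trans N1.
have mnv := @measurable_node_values R N.
have mA : measurable ((fun g : Gmeas R => node_values N g : vec N) @^-1` B).
  by rewrite -[X in measurable X]setTI; exact: mnv.
have mtA : measurable (tau hinv @^-1`
    ((fun g : Gmeas R => node_values N g : vec N) @^-1` B) : set (Gmeas R)).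
  by rewrite -[X in measurable X]setTI; apply: measurable_tau.
have mhinv : measurable_fun setT hinv by exact: continuous_measurable_fun.
have mh : measurable_fun setT h by exact: continuous_measurable_fun.
have m1B : measurable_fun setT (fun x : vec N => (\1_B x)%:E : \bar R).
  by apply/measurable_EFinP; exact: measurable_indic.
pose F1 (x : vec N) : \bar R := (\1_B (shift_map hinv N x))%:E.
have mF1 : measurable_fun setT F1.
  exact: (measurableT_comp m1B (measurable_shift_map N mhinv)).
pose F2 (x : vec N) : \bar R := ((Ynode beta h N x)%:E * (\1_B x)%:E)%E.
have mF2 : measurable_fun setT F2.
  by apply: emeasurable_funM => //; apply/measurable_EFinP; exact: measurable_Ynode.
have md : measurable_fun setT (fun x : vec N => (dirdens beta N (node N) x)%:E).
  by apply/measurable_EFinP; exact: measurable_dirdens.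
have F10 x : (0 <= F1 x)%E by rewrite lee_fin.
have F20 x : (0 <= F2 x)%E by rewrite mule_ge0// lee_fin ?Ynode_ge0.
transitivity (\int[Q]_g F1 (node_values N g))%E.
  rewrite -[LHS]/(Q _) -[X in Q X]setIT -integral_indic//; apply: eq_integral => g _.
  by rewrite /F1 -node_values_tau !indicE; congr (_%:R%:E); rewrite !in_setE.
(* On the left the law is written as an iterated integral and [x = h y] is substituted, which
   cancels [hinv] inside the indicator of [B]. *)
rewrite (node_law hQ)// (@iint_subst _ _ _ hG hC2 hinvC2 hK hinvK N)//; last 2 first.
- exact: emeasurable_funM.
- by move=> x; rewrite mule_ge0// lee_fin dirdens_ge0.
transitivity (\int[Q]_g F2 (node_values N g))%E; last first.
  rewrite [RHS]integral_mkcond; apply: eq_integral => g _; rewrite /F2 patchE indicE.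
  rewrite (_ : (node_values N g \in B) = (g \in (fun g : Gmeas R => node_values N g : vec N) @^-1` B)).
    by case: ifP => _; rewrite ?mule1 ?mule0.
  by apply/idP/idP => /set_mem hg; apply/mem_set.
rewrite (node_law hQ)//; apply: iint_eq => x x01 x0.
have sx : shift_map hinv N (shift_map h N x) = x.
  apply/funext => i; rewrite /shift_map; case iN : (i < N)%N => //.
  by rewrite frac_isGlift// hK frac_id// x01.
rewrite /F1 /F2 sx -!EFinM; congr (_%:E).
by rewrite mulrA dirdens_shift//; ring.
Qed.

Lemma Ynodes_cvg (g : Gty R) :
  Ynode beta h (nodes n) (node_values (nodes n) g) @[n --> \oo] --> Yb beta h g.
Proof.
rewrite (_ : (fun n => _) = (fun N => Ynode beta h N (fun i => evG (node N i) g)) \o nodes).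
  apply: cvg_comp nodes_cvg _.
  exact: (Ynode_cvg beta0 hG hC2 hinvC2 hK).
by apply/funext => n /=; rewrite Ynode_values// (ltn_trans _ (nodes_gt1 n)).
Qed.

Lemma Ynodes_bound : exists K : R, forall (g : Gty R) n,
  expR (- K) <= Ynode beta h (nodes n) (node_values (nodes n) g) <= expR K.
Proof.
have [L L0 [_ Lc _ Ld]] := ln_chord_bounds hG hC2 hinvC2 hK.
exists (beta * L + L) => g n; have N0 : (0 < nodes n)%N by apply: ltn_trans (nodes_gt1 n).
rewrite Ynode_values// (Ynode_lnY beta hG hC2 hinvC2 hK g N0) !ler_expR.
have := lnY_bound beta0 g Lc Ld N0; rewrite ler_norml lerNl.
by [].
Qed.

Lemma Yb_bound : exists K : R, forall g : Gty R, expR (- K) <= Yb beta h g <= expR K.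
Proof.
have [K hb] := Ynodes_bound; exists K => g; have c := @Ynodes_cvg g.
rewrite -(cvg_lim _ c)//; apply/andP; split.
- apply: limr_ge; first by apply/cvg_ex; exists (Yb beta h g).
  by apply: nearW => n; have /andP[] := hb g n.
- apply: limr_le; first by apply/cvg_ex; exists (Yb beta h g).
  by apply: nearW => n; have /andP[] := hb g n.
Qed.

Lemma measurable_Ynodes n :
  measurable_fun [set: Gmeas R] (fun g => Ynode beta h (nodes n) (node_values (nodes n) g)).
Proof.
apply: (measurableT_comp (measurable_Ynode _) (@measurable_node_values R (nodes n))).
exact: ltn_trans (nodes_gt1 n).
Qed.

Lemma measurable_Yb : measurable_fun [set: Gmeas R] (fun g => Yb beta h g).
Proof.
apply: (measurable_fun_cvg (h := fun n (g : Gmeas R) =>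
  Ynode beta h (nodes n) (node_values (nodes n) g))).
- exact: measurable_Ynodes.
- by move=> g _; exact: Ynodes_cvg.
Qed.

(** Asking for all sufficiently fine grids makes intersections immediate and lets [node_transform]
    be applied to a fixed set for all large [n]. *)
Definition node_cylinders : set (set (Gmeas R)) :=
  [set A | exists n0, forall n, (n0 <= n)%N -> exists2 B : set (@vec R (nodes n)), measurable B &
    A = (fun g : Gmeas R => node_values (nodes n) g : vec (nodes n)) @^-1` B].

Lemma setI_closed_node_cylinders : setI_closed node_cylinders.
Proof.
move=> A A' [n0 h0] [n1 h1]; exists (maxn n0 n1) => n.
rewrite geq_max => /andP[/h0[B mB ->] /h1[B' mB' ->]].
by exists (B `&` B'); [exact: measurableI|].
Qed.

(** Grids are nested, so node [i] of grid [n] is node [i * 2 ^ (m - n)] of grid [m]. The last node,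
    [i = nodes n], is the same point of the circle as node 0. *)
Lemma node_cylinder_coord n i (B : set R) : (i <= nodes n)%N -> measurable B ->
  node_cylinders ((fun g : Gmeas R => evG (node (nodes n) i) g) @^-1` B).
Proof.
wlog iN : i / (i < nodes n)%N.
  move=> wl; rewrite leq_eqVlt => /orP[/eqP ->|iN]; last exact: wl iN (ltnW iN).
  move=> mB; have N0 : (0 < nodes n)%N by apply: ltn_trans (nodes_gt1 n).
  rewrite (_ : (fun g => _) = (fun g : Gmeas R => evG (node (nodes n) 0) g)); first exact: wl.
  apply/funext => g; have iN : ((nodes n).-1 < nodes n)%N by rewrite prednK.
  by have := evG_nxt g iN; rewrite /nxt prednK// eqxx => ->.
move=> _ mB; exists n => m nm; pose j := (i * 2 ^ (m - n))%N.
have e2 : nodes m = (nodes n * 2 ^ (m - n))%N by rewrite /nodes -expnD addSn subnKC.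
have jN : (j < nodes m)%N by rewrite e2 /j ltn_pmul2r// expn_gt0.
exists ((fun x : vec (nodes m) => x j : R) @^-1` B).
  by rewrite -[X in measurable X]setTI; exact: measurable_coord.
have nij : node (nodes n) i = node (nodes m) j :> R.
  rewrite /node e2 /j !natrM; field.
  by rewrite !pnatr_eq0 -!lt0n expn_gt0 (ltn_trans _ (nodes_gt1 n)).
by apply/seteqP; split => g /=; rewrite /node_values jN nij.
Qed.

(** The chosen node is the first one strictly to the right of [t], so right continuity of [g]
    applies. *)
Lemma evG_right_cvg (g : Gty R) t : 0 <= t < 1 ->
  evG (node (nodes n) (Num.truncn (t * (nodes n)%:R)).+1) g @[n --> \oo] --> evG t g.
Proof.
move=> /andP[t0 t1]; set f := sval g; have fG : isGlift f := Gty_lift g.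
have /andP[f0 f1] := frac_itv (f t).
apply/cvgrPdist_lt => /= e e0.
(* The second bound keeps [f s] below the next integer, where [frac] is discontinuous. *)
have d0 : 0 < Num.min e (1 - frac (f t)) by rewrite lt_min e0 subr_gt0.
have [r r0 hr] := lift_right_cont fG t d0.
have [N0 hN] := invr_nat_lt r0.
have near0 : \forall N \near \oo, (N0 <= N)%N by exists N0.
have near1 : \forall n \near \oo, (N0 <= nodes n)%N := nodes_cvg near0.
apply: filterS near1 => n /= /hN[Np Nr].
have N0' : 0 < (nodes n)%:R :> R by rewrite ltr0n.
set s := node _ _.
have ts : t <= s < t + r.
  have tn0 : 0 <= t * (nodes n)%:R by rewrite mulr_ge0// ltW.
  have /andP[s1 s2] := truncn_itv tn0.
  rewrite /s; apply/andP; split; first by rewrite ler_pdivlMr// ltW.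
  apply: le_lt_trans (_ : t + (nodes n)%:R^-1 < _); last by rewrite ltrD2l.
  by rewrite nodeS lerD2r ler_pdivrMr.
have := hr s ts; rewrite -ltrBlDl lt_min => /andP[h1 h2].
have ft : f t <= f s by apply: fG.1; have /andP[] := ts.
have -> : evG s g = frac (f t) + (f s - f t).
  apply: (@frac_eq _ _ _ (Num.floor (f t))).
    by apply/andP; split; lra.
  by rewrite /frac -/f; ring.
by rewrite /evG -/f opprD addrA subrr add0r normrN ger0_norm ?subr_ge0.
Qed.

(** Evaluation at any [t] is a pointwise limit of evaluations at dyadic nodes, hence measurable for
    the sigma-algebra that the node cylinders generate. *)
Lemma Gmeas_node_cylinders : @measurable _ (Gmeas R) = <<s node_cylinders >>.
Proof.
apply/seteqP; split; last first.
  apply: smallest_sub; first exact: sigma_algebra_measurable.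
  move=> A [n /(_ n (leqnn n))[B mB ->]].
  by rewrite -[X in measurable X]setTI; exact: measurable_node_values.
apply: smallest_sub; first exact: smallest_sigma_algebra.
move=> _ [t [B [mB ->]]].
have mt : measurable_fun [set: g_sigma_algebraType node_cylinders] (fun g : Gty R => evG t g).
  have -> : (fun g : Gty R => evG t g) = (fun g => evG (frac t) g).
    apply/funext => g; rewrite /evG.
    have -> : frac t = t + (- Num.floor t)%:~R by rewrite /frac mulrNz.
    by rewrite (isGliftDz (Gty_lift g)) fracDz.
  apply: (measurable_fun_cvg (h := fun n (g : g_sigma_algebraType node_cylinders) =>
    evG (node (nodes n) (Num.truncn (frac t * (nodes n)%:R)).+1) g)); last first.
    by move=> g _; exact: evG_right_cvg (frac_itv t).
  move=> n _ C mC; rewrite setTI; apply: sub_sigma_algebra; apply: node_cylinder_coord => //.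
  have /andP[t0 t1] := frac_itv t.
  have N0 : 0 < (nodes n)%:R :> R by rewrite ltr0n (ltn_trans _ (nodes_gt1 n)).
  have tn0 : 0 <= frac t * (nodes n)%:R by rewrite mulr_ge0// ltW.
  have /andP[s1 _] := truncn_itv tn0.
  by rewrite -(ltr_nat R); apply: le_lt_trans s1 _; rewrite gtr_pMl.
by have := mt measurableT B mB; rewrite setTI.
Qed.

Lemma cylinder_transform (A : set (Gmeas R)) : node_cylinders A ->
  (Q (tau hinv @^-1` A) = \int[Q]_(g in A) (Yb beta h g)%:E)%E.
Proof.
move=> cA; have mA : measurable A by rewrite Gmeas_node_cylinders; exact: sub_sigma_algebra.
case: cA => n0 cA.
have [K hb] := Ynodes_bound.
pose Yn n (g : Gmeas R) := (Ynode beta h (nodes n) (node_values (nodes n) g))%:E.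
have mY n : measurable_fun A (Yn n).
  by apply: measurable_funTS; apply/measurable_EFinP; exact: measurable_Ynodes.
have mYb : measurable_fun A (fun g : Gmeas R => (Yb beta h g)%:E).
  by apply: measurable_funTS; apply/measurable_EFinP; exact: measurable_Yb.
have c1 : {ae Q, forall g, A g -> Yn ^~ g @ \oo --> (Yb beta h g)%:E}.
  apply: aeW => g _; apply/fine_cvgP; split; first exact: nearW.
  exact: Ynodes_cvg.
have c2 : {ae Q, forall g n, A g -> (`|Yn n g| <= (EFin \o cst (expR K)) g)%E}.
  apply: aeW => g n _ /=; rewrite lee_fin ger0_norm ?Ynode_ge0//.
  by have /andP[] := hb g n.
have [_ _ dc] := dominated_convergence mA mY mYb c1 (finite_measure_integrable_cst Q _ mA) c2.
(* For all large [n] the integral of [Yn n] over [A] equals the same number, the left side, so its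
   limit is that number. *)
apply/esym; rewrite -(cvg_lim _ dc)//; apply: lim_near_cst => //.
exists n0 => // n /= /cA[B mB ->].
exact/esym/(node_transform (nodes_gt1 n) mB).
Qed.

Lemma quasi_invariance (A : set (Gmeas R)) : measurable A ->
  (Q (tau hinv @^-1` A) = \int[Q]_(g in A) (Yb beta h g)%:E)%E.
Proof.
move=> mA; have mt := measurable_tau hinvG hinvc.
pose X : {mfun Gmeas R >-> Gmeas R} :=
  HB.pack (tau hinv : Gmeas R -> Gmeas R) (isMeasurableFun.Build _ _ _ _ _ mt).
have Yb0 (g : Gmeas R) : 0 <= Yb beta h g by rewrite mulr_ge0 ?expR_ge0.
have fin : (distribution Q X setT < +oo)%E by rewrite probability_setT ltry.
apply: (@measure_unique_pi R _ _ (distribution Q X) (mdens Q measurable_Yb Yb0) _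
  Gmeas_node_cylinders setI_closed_node_cylinders) => //.
- apply: cylinder_transform; exists 0%N => n _; exists setT => //.
- exact: cylinder_transform.
Qed.

End Transform.

Unset Implicit Arguments.

Theorem theorem4p1 (R : realType) (beta : R) (hbeta : 0 < beta)
    (h hinv : R -> R) (hG : isGlift h) (hC2 : isC2 h) (hinvC2 : isC2 hinv)
    (hK : cancel h hinv) (hinvK : cancel hinv h)
    (Q : probability (Gmeas R) R) (hQ : isQbeta beta Q) :
  (cancel (tau h) (tau hinv) /\ cancel (tau hinv) (tau h)) /\
  (forall A : set (Gmeas R), measurable A ->
     Q (tau hinv @^-1` A) = (\int[Q]_(g in A) (Yb beta h g)%:E)%E) /\
  (exists c C : R, 0 < c /\ forall g : Gty R, c <= Yb beta h g <= C).
Proof.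
have hinvG := isGlift_inv hG hinvC2 hK hinvK.
have hc := derivable_continuous hC2.1; have hinvc := derivable_continuous hinvC2.1.
split; first by split; exact: tauK.
split; first exact: quasi_invariance.
have [K hb] := Yb_bound hbeta hG hC2 hinvC2 hK.
by exists (expR (- K)), (expR K); split; [exact: expR_gt0|exact: hb].
Qed.
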